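(* Let $\Omega$, $a$, $f$ be as in the context, and assume that $a\in C^1(\Omega)$ and $\frac{\partial a}{\partial s}(u,s)>0$ for all $(u,s)\in\Omega$. Then there exists $\sigma_r>0$ such that the equation $\mathbf u_t=(a(\mathbf u,\mathbf u_x))_x+f(\mathbf u)$ has a classic travelling wave moving at speed $\sigma$ for each $\sigma>\sigma_r$. Moreover, there are no classic travelling waves moving at a speed $\sigma<\sigma_r$.
   Context: $\Omega=\{(u,s)\in\mathbb R^2: u\in[0,1],\ \omega_-(u)<s<\omega_+(u)\}$, where $\omega_+:[0,1]\to(0,\infty]$ is lower semicontinuous and $\omega_-=-\omega_+$ (so $\Omega$ is relatively open in $[0,1]\times\mathbb R$). The flux $a:\Omega\to\mathbb R$ is continuous, satisfies $a(u,-s)=-a(u,s)$, and $s\mapsto a(u,s)$ is increasing for every $u$. Put $a_\pm(u)=\lim_{s\to\omega_\pm(u)}a(u,s)\in[-\infty,\infty]$; it is assumed that $a_+(u)=\infty$ whenever $\omega_+(u)<\infty$. The reaction term satisfies $f\in C^1[0,1]$, $f(0)=f(1)=0$, $f(u)>0$ for $u\in(0,1)$. A classic travelling wave moving at speed $\sigma\in\mathbb R$ is a solution $\mathbf u(t,x)=u(x+\sigma t)$ where the profile $u\in C^2(\mathbb R)$ is strictly increasing, takes values in $[0,1]$, satisfies $(u(\xi),u'(\xi))\in\Omega$ for all $\xi\in\mathbb R$, $u(-\infty)=0$, $u(+\infty)=1$, and $(a(u,u'))'-\sigma u'+f(u)=0$ on $\mathbb R$. *)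

(* Defs.v *)
From Stdlib Require Import Reals.
From Coquelicot Require Import Coquelicot.

Set Implicit Arguments.
Open Scope R_scope.

Definition unit_interval (u : R) : Prop := 0 <= u <= 1.

Definition lower_semicontinuous_on (D : R -> Prop) (w : R -> Rbar) : Prop :=
  forall u, D u -> forall y : R, Rbar_lt y (w u) ->
    within D (locally u) (fun v => Rbar_lt y (w v)).

(* Derivative of [g] at [x] relative to [D]: one-sided at the endpoints when
   [D] is an interval, and independent of the values of [g] outside [D]
   (for [x] in [D]). *)
Definition is_derive_within (D : R -> Prop) (g : R -> R) (x l : R) : Prop :=
  filterdiff g (within D (locally x)) (fun h => scal h l).

Definition C1_unit_interval (f : R -> R) : Prop :=
  exists df : R -> R,
    (forall u, unit_interval u -> is_derive_within unit_interval f u (df u)) /\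
    continuous_on unit_interval df.

(* [omega] plays the role of omega_+; omega_- is its opposite. Only its values
   on [0,1] matter, and likewise only the values of [a] on [Omega omega] and of
   [f] on [0,1] matter in what follows. *)
Definition Omega (omega : R -> Rbar) (p : R * R) : Prop :=
  unit_interval (fst p) /\
  Rbar_lt (Rbar_opp (omega (fst p))) (snd p) /\ Rbar_lt (snd p) (omega (fst p)).

Definition admissible_domain (omega : R -> Rbar) : Prop :=
  (forall u, unit_interval u -> Rbar_lt 0 (omega u)) /\
  lower_semicontinuous_on unit_interval omega.

(* In the last clause only the limit at omega_+ is prescribed: the one at
   omega_- follows from oddness. *)
Definition admissible_flux (omega : R -> Rbar) (a : R * R -> R) : Prop :=
  continuous_on (Omega omega) a /\
  (forall u s, Omega omega (u, s) -> a (u, - s) = - a (u, s)) /\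
  (forall u s1 s2, Omega omega (u, s1) -> Omega omega (u, s2) ->
     s1 < s2 -> a (u, s1) < a (u, s2)) /\
  (forall u w : R, unit_interval u -> omega u = Finite w ->
     filterlim (fun s => a (u, s)) (at_left w) (Rbar_locally p_infty)).

Definition admissible_reaction (f : R -> R) : Prop :=
  C1_unit_interval f /\ f 0 = 0 /\ f 1 = 0 /\ (forall u, 0 < u < 1 -> 0 < f u).

(* The sections of [Omega omega] at fixed [u] are open, so the derivative in
   [s] is two-sided; the one in [u] is one-sided at u = 0 and u = 1. *)
Definition C1_Omega (omega : R -> Rbar) (a : R * R -> R) : Prop :=
  exists a_u a_s : R * R -> R,
    (forall u s, Omega omega (u, s) ->
       is_derive_within (fun v => Omega omega (v, s))
         (fun v => a (v, s)) u (a_u (u, s)) /\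
       is_derive (fun r => a (u, r)) s (a_s (u, s))) /\
    continuous_on (Omega omega) a_u /\ continuous_on (Omega omega) a_s.

Definition C2 (u : R -> R) : Prop :=
  (forall x, ex_derive u x) /\ (forall x, ex_derive (Derive u) x) /\
  (forall x, continuous (Derive (Derive u)) x).

(* U t x solves  U_t = (a(U, U_x))_x + f(U)  on R x R. *)
Definition pde_solution (omega : R -> Rbar) (a : R * R -> R) (f : R -> R)
    (U : R -> R -> R) : Prop :=
  forall t x,
    Omega omega (U t x, Derive (U t) x) /\
    ex_derive (fun tau => U tau x) t /\
    ex_derive (U t) x /\
    ex_derive (fun y => a (U t y, Derive (U t) y)) x /\
    Derive (fun tau => U tau x) t
      = Derive (fun y => a (U t y, Derive (U t) y)) x + f (U t x).

Definition classic_profile (omega : R -> Rbar) (a : R * R -> R) (f : R -> R)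
    (sigma : R) (u : R -> R) : Prop :=
  C2 u /\
  (forall x y, x < y -> u x < u y) /\
  (forall x, 0 <= u x <= 1) /\
  (forall x, Omega omega (u x, Derive u x)) /\
  is_lim u m_infty 0 /\
  is_lim u p_infty 1 /\
  (forall x, ex_derive (fun y => a (u y, Derive u y)) x /\
     Derive (fun y => a (u y, Derive u y)) x - sigma * Derive u x + f (u x) = 0).

Definition classic_travelling_wave (omega : R -> Rbar) (a : R * R -> R)
    (f : R -> R) (sigma : R) (U : R -> R -> R) : Prop :=
  pde_solution omega a f U /\
  exists u : R -> R,
    classic_profile omega a f sigma u /\
    (forall t x, U t x = u (x + sigma * t)).

(* Main.v *)
Require Import Defs.
From Stdlib Require Import Reals Lra ClassicalEpsilon.
From Coquelicot Require Import Coquelicot.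
Open Scope R_scope.

(* The set of admissible speeds is nonempty, upward closed and bounded below by
   a positive number; [sigma_r] is its infimum.

   Call barrier at speed [sigma] an increasing profile [u] joining 0 to 1 whose
   flux [V = a(u, u')] satisfies [V' <= sigma u' - f(u)]. Parametrizing by the
   position [x] along [u], a wave at speed [sigma] amounts to a flux [w] with
   [0 < w <= V] and
     [w' = (sigma - f(u) / g(u, w)) u'],   [g(u, .)] the inverse of [a(u, .)];
   the new profile is [u] after the time change [tau' = u' / g(u, w) >= 1], which
   therefore still takes infinite time at both ends. For small [kappa] the curve
   [kappa f(u)] lies below [V] and satisfies the reverse inequality, so it
   excludes [w = 0]. The right-hand side increases with [w] at a rate at most
   [lambda = Q u' / f(u)] between the two curves; hence [z = exp(- int lambda) w]
   solves [z' = - H(x, z)] with [H >= 0] nondecreasing in [z], and such a solution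
   is a fixed point of the monotone operator [z |-> int_x^oo H(s, z) ds].

   A wave at speed [sigma0] is a barrier at every larger speed, and a logistic
   profile is a barrier at large speeds. The lower bound comes from
   [a(u, u') <= sigma u], which forces slow waves to be flat. *)

(** * Continuity, monotonicity and suprema on the real line *)

Lemma continuous_eps_delta (g : R -> R) (x : R) :
  continuous g x <->
  forall eps, 0 < eps -> exists delta, 0 < delta /\
    forall y, Rabs (y - x) < delta -> Rabs (g y - g x) < eps.
Proof.
  split.
  - intros Hg eps Heps.
    destruct (proj1 (filterlim_locally g (g x)) Hg (mkposreal eps Heps)) as [d Hd].
    exists d; split; [apply cond_pos|]. intros y Hy. exact (Hd y Hy).
  - intros H. apply filterlim_locally. intros eps.
    destruct (H eps (cond_pos eps)) as [d [Hd1 Hd2]].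
    exists (mkposreal d Hd1). intros y Hy. exact (Hd2 y Hy).
Qed.

Lemma derive_nonneg_nondecreasing (g dg : R -> R) (x y : R) :
  x <= y ->
  (forall t, x <= t <= y -> is_derive g t (dg t)) ->
  (forall t, x <= t <= y -> 0 <= dg t) -> g x <= g y.
Proof.
  intros Hxy Hd Hpos.
  destruct (MVT_gen g x y dg) as [c [Hc1 Hc2]].
  - intros t Ht. apply Hd. rewrite Rmin_left, Rmax_right in Ht by easy. lra.
  - intros t Ht. apply continuity_pt_filterlim.
    apply (ex_derive_continuous g). exists (dg t). apply Hd.
    rewrite Rmin_left, Rmax_right in Ht by easy. lra.
  - rewrite Rmin_left, Rmax_right in Hc1 by easy.
    specialize (Hpos c Hc1). nra.
Qed.

Lemma Lub_Rbar_real (E : R -> Prop) (r0 B : R) :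
  E r0 -> (forall r, E r -> r <= B) -> is_lub E (real (Lub_Rbar E)).
Proof.
  intros H0 HB.
  destruct (Lub_Rbar_correct E) as [H1 H2].
  assert (Hle : Rbar_le (Lub_Rbar E) B) by (apply H2; intros r Hr; apply HB, Hr).
  specialize (H1 r0 H0) as H1'.
  destruct (Lub_Rbar E) as [l| |]; simpl in *; try easy.
  split.
  - intros r Hr. exact (H1 r Hr).
  - intros b Hb. apply (H2 (Finite b)). intros r Hr. exact (Hb r Hr).
Qed.

(** * A monotone scalar equation with zero limit at infinity *)

Section MonotoneOde.

Context (H : R -> R -> R) (alpha beta dalpha dbeta : R -> R).
Context (Dalpha : forall x, is_derive alpha x (dalpha x))
  (Dbeta : forall x, is_derive beta x (dbeta x))
  (alpha_nonneg : forall x, 0 <= alpha x)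
  (alpha_le_beta : forall x, alpha x <= beta x)
  (H_mono : forall x z1 z2,
    alpha x <= z1 -> z1 <= z2 -> z2 <= beta x -> H x z1 <= H x z2)
  (H_nonneg : forall x z, alpha x <= z <= beta x -> 0 <= H x z)
  (H_cont : forall z, (forall x, continuous z x) ->
    (forall x, alpha x <= z x <= beta x) ->
    forall x, continuous (fun y => H y (z y)) x)
  (alpha_sub : forall x, - H x (alpha x) <= dalpha x)
  (beta_super : forall x, dbeta x <= - H x (beta x))
  (alpha_lim : is_lim alpha p_infty 0).

Let between (z : R -> R) := forall x, alpha x <= z x <= beta x.
Let good (z : R -> R) := (forall x, continuous z x) /\ between z.
Let K (z : R -> R) (x : R) := RInt (fun y => H y (z y)) 0 x.
(** For a good [z] the primitive [K z] is nondecreasing, so its supremum over the half-line is the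
    integral of [H s (z s)] from 0 to infinity. Hence [T z x] is the tail integral from [x] on,
    obtained without improper integrals; the extraction [real] is harmless because [E_lub] shows the
    supremum to be finite. *)
Let E (z : R -> R) (r : R) := exists y, 0 <= y /\ r = K z y.
Let T (z : R -> R) (x : R) := real (Lub_Rbar (E z)) - K z x.

Local Lemma K_derive z : good z -> forall x, is_derive (K z) x (H x (z x)).
Proof.
  intros [Hc Hb] x.
  apply (is_derive_RInt (fun y => H y (z y)) (K z) 0 x).
  - apply filter_forall. intros y. apply (RInt_correct (fun y => H y (z y)) 0 y), (ex_RInt_continuous (fun y => H y (z y))).
    intros; apply H_cont; easy.
  - apply H_cont; easy.
Qed.

Local Lemma good_alpha : good alpha.
Proof.
  split.
  - intros x. apply (ex_derive_continuous alpha). eexists; apply Dalpha.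
  - intros x. pose proof (alpha_le_beta x); lra.
Qed.

Local Lemma good_beta : good beta.
Proof.
  split.
  - intros x. apply (ex_derive_continuous beta). eexists; apply Dbeta.
  - intros x. pose proof (alpha_le_beta x); lra.
Qed.

Local Lemma K_mono z : good z -> forall x y, x <= y -> K z x <= K z y.
Proof.
  intros Hz x y Hxy.
  apply (derive_nonneg_nondecreasing (K z) (fun t => H t (z t))); try easy.
  - intros; apply K_derive, Hz.
  - intros; apply H_nonneg, Hz.
Qed.

Local Lemma K_incr_mono z1 z2 : good z1 -> good z2 -> (forall x, z1 x <= z2 x) ->
  forall x y, x <= y -> K z1 y - K z1 x <= K z2 y - K z2 x.
Proof.
  intros Hz1 Hz2 Hle x y Hxy.
  enough (K z2 x - K z1 x <= K z2 y - K z1 y) by lra.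
  apply (derive_nonneg_nondecreasing (fun t => K z2 t - K z1 t)
    (fun t => H t (z2 t) - H t (z1 t))); try easy.
  - intros; apply (is_derive_minus (K z2) (K z1)); apply K_derive; easy.
  - intros t _. enough (H t (z1 t) <= H t (z2 t)) by lra.
    apply H_mono; [apply Hz1| apply Hle | apply Hz2].
Qed.

Local Lemma K_beta x y : x <= y -> K beta y - K beta x <= beta x - beta y.
Proof.
  intros Hxy.
  enough (- K beta x - beta x <= - K beta y - beta y) by lra.
  apply (derive_nonneg_nondecreasing (fun t => - K beta t - beta t)
    (fun t => - H t (beta t) - dbeta t)); try easy.
  - intros. apply (is_derive_minus (fun t => - K beta t) beta); [|apply Dbeta].
    apply (is_derive_opp (K beta)). apply K_derive, good_beta.
  - intros t _. pose proof (beta_super t). lra.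
Qed.

Local Lemma K_alpha x y : x <= y -> alpha x - alpha y <= K alpha y - K alpha x.
Proof.
  intros Hxy.
  enough (K alpha x + alpha x <= K alpha y + alpha y) by lra.
  apply (derive_nonneg_nondecreasing (fun t => K alpha t + alpha t)
    (fun t => H t (alpha t) + dalpha t)); try easy.
  - intros. apply (is_derive_plus (K alpha) alpha); [|apply Dalpha].
    apply K_derive, good_alpha.
  - intros t _. pose proof (alpha_sub t). lra.
Qed.

(** Over [[x, y]] the integral of [H s (z s)] is at most that for [beta], which [K_beta] bounds by
    [beta x - beta y], and [beta y >= 0]. This makes every tail integral finite. *)
Local Lemma K_upper z x y : good z -> x <= y -> K z y <= K z x + beta x.
Proof.
  intros Hz Hxy.
  pose proof (K_incr_mono z beta Hz good_beta (fun t => proj2 (proj2 Hz t)) x y Hxy).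
  pose proof (K_beta x y Hxy).
  pose proof (alpha_nonneg y); pose proof (alpha_le_beta y). lra.
Qed.

Local Lemma E_lub z : good z -> is_lub (E z) (real (Lub_Rbar (E z))).
Proof.
  intros Hz. apply (Lub_Rbar_real _ (K z 0) (K z 0 + beta 0)).
  - exists 0; split; [lra|easy].
  - intros r [y [Hy ->]]. apply K_upper; easy.
Qed.

Local Lemma T_diff z x y : T z x - T z y = K z y - K z x.
Proof. unfold T; lra. Qed.

Local Lemma T_le_beta z x : good z -> T z x <= beta x.
Proof.
  intros Hz. unfold T.
  enough (real (Lub_Rbar (E z)) <= K z x + beta x) by lra.
  apply (E_lub z Hz). intros r [y [Hy ->]].
  destruct (Rle_lt_dec x y) as [Hxy|Hxy].
  - apply K_upper; easy.
  - pose proof (K_mono z Hz y x (Rlt_le _ _ Hxy)).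
    pose proof (alpha_nonneg x); pose proof (alpha_le_beta x). lra.
Qed.

Local Lemma K_le_lub z y : good z -> K z y <= real (Lub_Rbar (E z)).
Proof.
  intros Hz. apply Rle_trans with (K z (Rmax 0 y)).
  - apply K_mono; [easy|apply Rmax_r].
  - apply (E_lub z Hz). exists (Rmax 0 y). split; [apply Rmax_l|easy].
Qed.

(** The subsolution inequality integrated over [[x, y]] leaves a boundary term [alpha y], which
    tends to 0 as [y] grows. *)
Local Lemma T_ge_alpha z x : good z -> alpha x <= T z x.
Proof.
  intros Hz. apply le_epsilon. intros eps Heps.
  apply is_lim_spec in alpha_lim.
  destruct (alpha_lim (mkposreal eps Heps)) as [Y HY].
  set (y := Rmax x (Y + 1)).
  assert (Hxy : x <= y) by apply Rmax_l.
  assert (HYy : Y < y) by (pose proof (Rmax_r x (Y + 1)); unfold y; lra).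
  specialize (HY y HYy). simpl in HY. apply Rabs_def2 in HY.
  pose proof (K_incr_mono alpha z good_alpha Hz (fun t => proj1 (proj2 Hz t)) x y Hxy).
  pose proof (K_alpha x y Hxy). pose proof (K_le_lub z y Hz). unfold T. lra.
Qed.

Local Lemma T_mono z1 z2 : good z1 -> good z2 -> (forall x, z1 x <= z2 x) ->
  forall x, T z1 x <= T z2 x.
Proof.
  intros Hz1 Hz2 Hle x. unfold T.
  enough (real (Lub_Rbar (E z1)) <= real (Lub_Rbar (E z2)) - K z2 x + K z1 x) by lra.
  apply (E_lub z1 Hz1). intros r [y [Hy ->]].
  destruct (Rle_lt_dec x y) as [Hxy|Hxy].
  - pose proof (K_incr_mono z1 z2 Hz1 Hz2 Hle x y Hxy).
    pose proof (K_le_lub z2 y Hz2). lra.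
  - pose proof (K_mono z1 Hz1 y x (Rlt_le _ _ Hxy)).
    pose proof (K_le_lub z2 x Hz2). lra.
Qed.

(** All members share a modulus of continuity, taken from [K beta], so a pointwise supremum of
    members is again continuous; continuity alone would not survive suprema. *)
Let lattice (z : R -> R) :=
  between z /\ forall x y, x <= y -> 0 <= z x - z y <= K beta y - K beta x.

Local Lemma lattice_good z : lattice z -> good z.
Proof.
  intros [Hb Hl]. split; [|easy].
  intros x. apply continuous_eps_delta. intros eps Heps.
  assert (Hc : continuous (K beta) x).
  { apply (ex_derive_continuous (K beta)). eexists. apply K_derive, good_beta. }
  destruct (proj1 (continuous_eps_delta _ _) Hc eps Heps) as [d [Hd1 Hd2]].
  exists d; split; [easy|]. intros y Hy. specialize (Hd2 y Hy).
  apply Rabs_def2 in Hd2. apply Rabs_def1;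
  destruct (Rle_lt_dec x y) as [Hxy|Hxy];
    [specialize (Hl x y Hxy)|specialize (Hl y x (Rlt_le _ _ Hxy))|
     specialize (Hl x y Hxy)|specialize (Hl y x (Rlt_le _ _ Hxy))]; lra.
Qed.

Local Lemma T_lattice z : good z -> lattice (T z).
Proof.
  intros Hz. split.
  - intros x. split; [apply T_ge_alpha|apply T_le_beta]; easy.
  - intros x y Hxy. rewrite T_diff. split.
    + pose proof (K_mono z Hz x y Hxy); lra.
    + apply K_incr_mono; try easy. apply good_beta. intros t; apply (proj2 Hz).
Qed.

(** Post-fixed points of [T]; their pointwise supremum [w] is the Knaster-Tarski candidate for the
    greatest fixed point. *)
Let post (z : R -> R) := lattice z /\ forall x, z x <= T z x.
Let w (x : R) := real (Lub_Rbar (fun r => exists z, post z /\ r = z x)).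

Local Lemma T_alpha_post : post (T alpha).
Proof.
  split; [apply T_lattice, good_alpha|].
  apply T_mono; [apply good_alpha| |].
  - apply lattice_good, T_lattice, good_alpha.
  - intros y; apply T_ge_alpha, good_alpha.
Qed.

Local Lemma w_lub x : is_lub (fun r => exists z, post z /\ r = z x) (w x).
Proof.
  apply (Lub_Rbar_real _ (T alpha x) (beta x)).
  - exists (T alpha). split; [apply T_alpha_post|easy].
  - intros r [z [[[Hz _] _] ->]]. apply Hz.
Qed.

Local Lemma w_upper z x : post z -> z x <= w x.
Proof. intros Hz. apply (w_lub x). exists z; easy. Qed.

Local Lemma w_least x b : (forall z, post z -> z x <= b) -> w x <= b.
Proof. intros Hb. apply (w_lub x). intros r [z [Hz ->]]. now apply Hb. Qed.

Local Lemma w_lattice : lattice w.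
Proof.
  split.
  - intros x; split.
    + apply Rle_trans with (T alpha x); [apply T_ge_alpha, good_alpha|].
      apply w_upper, T_alpha_post.
    + apply w_least. intros z [[Hz _] _]. apply Hz.
  - intros x y Hxy. split.
    + enough (w y <= w x) by lra. apply w_least. intros z Hz.
      pose proof (w_upper z x Hz). pose proof (proj2 (proj1 Hz) x y Hxy). lra.
    + enough (w x <= w y + (K beta y - K beta x)) by lra.
      apply w_least. intros z Hz.
      pose proof (w_upper z y Hz). pose proof (proj2 (proj1 Hz) x y Hxy). lra.
Qed.

(* Knaster-Tarski for the monotone operator [T z x = int_x^oo H(s, z s) ds] on
   the complete lattice of functions between [alpha] and [beta] whose increments
   are dominated by those of [- K beta]. *)
Lemma monotone_ode_solution :
  exists z, (forall x, alpha x <= z x <= beta x) /\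
    forall x, is_derive z x (- H x (z x)).
Proof.
  assert (Hw : good w) by apply lattice_good, w_lattice.
  assert (Hle : forall x, w x <= T w x).
  { intros x. apply w_least. intros z Hz.
    apply Rle_trans with (T z x); [apply Hz|].
    apply T_mono; [apply lattice_good, Hz|easy|].
    intros y; now apply w_upper. }
  assert (Hfix : forall x, T w x = w x).
  { intros x. apply Rle_antisym; [|apply Hle].
    apply (w_upper (T w)). split; [now apply T_lattice|].
    apply T_mono; try easy. now apply lattice_good, T_lattice. }
  exists w. split; [apply Hw|].
  intros x. apply (is_derive_ext (T w)); [exact Hfix|].
  unfold T. replace (- H x (w x)) with (0 - H x (w x)) by lra.
  apply (is_derive_minus (fun _ => real (Lub_Rbar (E w))) (K w)).
  - exact (is_derive_const (K:=R_AbsRing) (V:=R_NormedModule) _ x).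
  - now apply K_derive.
Qed.

End MonotoneOde.

(** * Slope functions, inverse functions, compactness and bounds on the reaction *)

(** Caratheodory's form of the derivative. A continuous slope function can be composed and inverted
    by plain algebra, which drives the inverse, chain and implicit rules below. *)
Lemma is_derive_slope (g : R -> R) (x l : R) :
  is_derive g x l <->
  exists phi : R -> R, continuous phi x /\ phi x = l /\
    locally x (fun y => g y - g x = phi y * (y - x)).
Proof.
  split.
  - intros Hg. apply is_derive_Reals in Hg.
    exists (fun y => if Req_EM_T y x then l else (g y - g x) / (y - x)).
    split; [|split].
    + apply continuous_eps_delta. intros eps Heps.
      destruct (Hg eps Heps) as [d Hd]. exists d. split; [apply cond_pos|].
      intros y Hy. destruct (Req_EM_T x x) as [_|]; [|easy].
      destruct (Req_EM_T y x) as [->|Hne].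
      * rewrite Rminus_diag, Rabs_R0. easy.
      * specialize (Hd (y - x) ltac:(lra) Hy).
        replace (x + (y - x)) with y in Hd by lra. exact Hd.
    + destruct (Req_EM_T x x); easy.
    + apply filter_forall. intros y. destruct (Req_EM_T y x) as [->|Hne].
      * lra.
      * field. lra.
  - intros [phi [Hc [Hl [d Hd]]]]. apply is_derive_Reals. intros eps Heps.
    destruct (proj1 (continuous_eps_delta _ _) Hc eps Heps) as [d' [Hd'1 Hd'2]].
    assert (Hmin : 0 < Rmin d d') by (apply Rmin_pos; [apply cond_pos|easy]).
    exists (mkposreal _ Hmin). intros h Hh Hhd. simpl in Hhd.
    assert (H1 : Rabs (x + h - x) < Rmin d d') by (now replace (x + h - x) with h by lra).
    rewrite Hd by (apply (Rlt_le_trans _ _ _ H1), Rmin_l).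
    replace (phi (x + h) * (x + h - x) / h) with (phi (x + h)) by (field; easy).
    rewrite <- Hl. apply Hd'2. apply (Rlt_le_trans _ _ _ H1), Rmin_r.
Qed.

Lemma is_derive_within_interior (D : R -> Prop) (g : R -> R) (x l : R) :
  locally x D -> is_derive_within D g x l -> is_derive g x l.
Proof.
  intros HD [Hlin Hdom]. split; [exact Hlin|].
  intros y Hy eps.
  assert (Hlim : is_filter_lim (within D (locally x)) y).
  { intros P HP. specialize (Hy P HP). unfold within.
    revert Hy. apply filter_imp. easy. }
  pose proof (Hdom y Hlim eps) as Hd. unfold within in Hd.
  generalize (filter_and _ _ HD Hd). apply filter_imp. intros z [H1 H2]. now apply H2.
Qed.

(** Since [tau x - x] is nondecreasing, [tau] expands distances: it is onto by the intermediate
    value theorem, and its inverse is 1-Lipschitz. The slope function of [tau] then gives the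
    derivative of the inverse. *)
Lemma inverse_function_derive (tau d : R -> R) :
  (forall x, is_derive tau x (d x)) -> (forall x, 1 <= d x) ->
  exists X : R -> R, (forall t, tau (X t) = t) /\
    (forall x, X (tau x) = x) /\ (forall t, is_derive X t (/ d (X t))).
Proof.
  intros Hd H1.
  assert (Hexp : forall x y, x <= y -> y - x <= tau y - tau x).
  { intros x y Hxy. enough (tau x - x <= tau y - y) by lra.
    apply (derive_nonneg_nondecreasing (fun t => tau t - t) (fun t => d t - 1)); try easy.
    - intros t _. apply (is_derive_minus tau (fun t => t)); [apply Hd|].
      exact (is_derive_id (K:=R_AbsRing) t).
    - intros t _. specialize (H1 t). lra. }
  assert (Hsurj : forall t, exists x, tau x = t).
  (* Expansion gives [tau N >= tau 0 + N >= t], and symmetrically at [- N]. *)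
  { intros t. set (N := Rabs t + Rabs (tau 0)).
    assert (HN : 0 <= N) by (pose proof (Rabs_pos t); pose proof (Rabs_pos (tau 0)); unfold N; lra).
    pose proof (Hexp 0 N HN) as Hup. pose proof (Hexp (- N) 0 ltac:(lra)) as Hlo.
    pose proof (Rle_abs t). pose proof (Rle_abs (- t)). rewrite Rabs_Ropp in *.
    pose proof (Rle_abs (tau 0)). pose proof (Rle_abs (- tau 0)). rewrite Rabs_Ropp in *.
    destruct (IVT_gen tau (- N) N t) as [x [_ Hx]].
    - intros x. apply continuity_pt_filterlim. apply (ex_derive_continuous tau).
      now exists (d x).
    - unfold N in *. rewrite Rmin_left, Rmax_right; lra.
    - now exists x. }
  exists (fun t => epsilon (inhabits 0) (fun x => tau x = t)).
  set (X := fun t => epsilon (inhabits 0) (fun x => tau x = t)).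
  assert (HX : forall t, tau (X t) = t) by (intros t; apply epsilon_spec, Hsurj).
  assert (HXl : forall x, X (tau x) = x).
  { intros x. pose proof (HX (tau x)) as H.
    destruct (Rle_lt_dec x (X (tau x))) as [Hle|Hlt].
    - pose proof (Hexp _ _ Hle). lra.
    - pose proof (Hexp _ _ (Rlt_le _ _ Hlt)). lra. }
  split; [easy|]. split; [easy|]. intros t.
  destruct (proj1 (is_derive_slope _ _ _) (Hd (X t))) as [phi [Hp1 [Hp2 Hp3]]].
  assert (HXc : continuous X t).
  { apply continuous_eps_delta. intros eps Heps. exists eps. split; [easy|].
    intros y Hy. apply Rle_lt_trans with (2 := Hy).
    destruct (Rle_lt_dec (X t) (X y)) as [Hle|Hlt].
    - pose proof (Hexp _ _ Hle) as H. rewrite !HX in H.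
      rewrite !Rabs_pos_eq; lra.
    - pose proof (Hexp _ _ (Rlt_le _ _ Hlt)) as H. rewrite !HX in H.
      rewrite !(Rabs_minus_sym _ t), !(Rabs_minus_sym _ (X t)), !Rabs_pos_eq; lra. }
  assert (Hpc : continuous (fun s => phi (X s)) t) by (now apply continuous_comp).
  assert (Hp0 : phi (X t) <> 0) by (rewrite Hp2; specialize (H1 (X t)); lra).
  apply is_derive_slope. exists (fun s => / phi (X s)). split; [|split].
  - now apply continuous_Rinv_comp.
  - now rewrite Hp2.
  - assert (Hne : locally t (fun s => phi (X s) <> 0)).
    { destruct (proj1 (continuous_eps_delta _ _) Hpc (Rabs (phi (X t))) ltac:(now apply Rabs_pos_lt))
        as [e [He1 He2]].
      exists (mkposreal e He1). intros s Hs Habs. specialize (He2 s Hs). cbv beta in He2.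
      rewrite Habs, Rminus_0_l, Rabs_Ropp in He2. lra. }
    assert (Hs : locally t (fun s => tau (X s) - tau (X t) = phi (X s) * (X s - X t))).
    { exact (HXc _ Hp3). }
    generalize (filter_and _ _ Hne Hs). apply filter_imp. intros s [Hs1 Hs2].
    rewrite !HX in Hs2. fold (X s) (X t). rewrite Hs2. field. easy.
Qed.

Lemma exists_preimage (g : R -> R) (b y : R) :
  0 <= b -> (forall x, 0 <= x <= b -> continuous g x) -> g 0 <= y <= g b ->
  exists x, 0 <= x <= b /\ g x = y.
Proof.
  intros Hb Hc [H0 H1].
  destruct (Req_dec (g 0) y) as [<-|Hne0]; [exists 0; lra|].
  destruct (Req_dec (g b) y) as [<-|Hne1]; [exists b; lra|].
  destruct (Req_dec 0 b) as [<-|Hbne]; [lra|].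
  destruct (Ranalysis5.IVT_interv (fun x => g x - y) 0 b) as [x [Hx1 Hx2]]; try lra.
  - intros x Hx. apply continuity_pt_filterlim.
    apply (continuous_minus g (fun _ => y)); [now apply Hc|apply continuous_const].
  - exists x. split; [easy|lra].
Qed.

Lemma derive_neg_decreases (g : R -> R) (x l r : R) :
  is_derive g x l -> l < 0 -> 0 < r -> exists h, 0 < h <= r /\ g (x + h) < g x.
Proof.
  intros Hg Hl Hr. apply is_derive_Reals in Hg.
  destruct (Hg (- l) ltac:(lra)) as [d Hd]. pose proof (cond_pos d) as Hd0.
  exists (Rmin (d / 2) r).
  assert (Hh : 0 < Rmin (d / 2) r) by (apply Rmin_pos; lra).
  pose proof (Rmin_l (d / 2) r). pose proof (Rmin_r (d / 2) r).
  set (h := Rmin (d / 2) r) in *. split; [lra|].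
  specialize (Hd h ltac:(lra) ltac:(rewrite Rabs_pos_eq; lra)).
  apply Rabs_def2 in Hd. apply Rnot_le_lt. intros Hle.
  assert (0 <= (g (x + h) - g x) / h) by (apply Rdiv_le_0_compat; lra). lra.
Qed.

(** One parameter serves both as radius and as bound, so this covers several compactness arguments:
    [Q] of the form [g <= / e] yields boundedness, [e <= g] yields a positive lower bound, and
    [c = d] is the one-variable case. *)
Lemma compact_uniform (Q : R -> R -> R -> Prop) (a b c d : R) :
  (forall x y e e', 0 < e' <= e -> Q x y e -> Q x y e') ->
  (forall x y, a <= x <= b -> c <= y <= d -> exists delta, 0 < delta /\
    forall x' y', a <= x' <= b -> c <= y' <= d ->
      Rabs (x' - x) < delta -> Rabs (y' - y) < delta -> Q x' y' delta) ->
  exists e, 0 < e /\ forall x y, a <= x <= b -> c <= y <= d -> Q x y e.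
Proof.
  intros Hanti Hloc.
  set (good := fun x y (delta : posreal) => a <= x <= b -> c <= y <= d ->
    forall x' y', a <= x' <= b -> c <= y' <= d ->
      Rabs (x' - x) < delta -> Rabs (y' - y) < delta -> Q x' y' delta).
  assert (Hex : forall x y, exists delta, good x y delta).
  { intros x y. destruct (classic (a <= x <= b /\ c <= y <= d)) as [[Hx Hy]|Hn].
    - destruct (Hloc x y Hx Hy) as [delta [H1 H2]].
      exists (mkposreal delta H1). intros _ _. exact H2.
    (* The gauge must be defined on the whole plane; outside the rectangle any value will do. *)
    - exists (mkposreal 1 Rlt_0_1). intros Hx Hy; exfalso; now apply Hn. }
  set (delta := fun x y => epsilon (inhabits (mkposreal 1 Rlt_0_1)) (good x y)).
  assert (Hdelta : forall x y, good x y (delta x y)) by (intros x y; apply epsilon_spec, Hex).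
  destruct (compactness_value_2d a b c d delta) as [e He].
  exists e. split; [apply cond_pos|]. intros x y Hx Hy.
  (* [compactness_value_2d] asserts only the double negation of the existence of a nearby gauge
     point. *)
  apply NNPP. intros Hn. apply (He x y Hx Hy). intros [u [v [Hu [Hv [H1 [H2 H3]]]]]].
  apply Hn. apply Hanti with (delta u v); [split; [apply cond_pos|easy]|].
  now apply (Hdelta u v).
Qed.

Lemma is_derive_within_Lipschitz_at (D : R -> Prop) (g : R -> R) (x l : R) :
  D x -> is_derive_within D g x l ->
  exists delta, 0 < delta /\ forall y, D y -> Rabs (y - x) < delta ->
    Rabs (g y - g x) <= (Rabs l + 1) * Rabs (y - x).
Proof.
  intros Dx [_ Hdom].
  assert (Hlim : is_filter_lim (within D (locally x)) x).
  { intros P HP. unfold within. revert HP. apply filter_imp. easy. }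
  destruct (Hdom x Hlim (mkposreal 1 Rlt_0_1)) as [d Hd].
  exists d. split; [apply cond_pos|]. intros y Hy Hyd.
  specialize (Hd y Hyd Hy).
  change (Rabs (g y - g x - (y - x) * l) <= 1 * Rabs (y - x)) in Hd.
  replace (g y - g x) with ((g y - g x - (y - x) * l) + (y - x) * l) by ring.
  eapply Rle_trans; [apply Rabs_triang|]. rewrite Rabs_mult. lra.
Qed.

(** Compactness bounds the derivative. The resulting Lipschitz estimate and the zeros at 0 and 1
    bound [f r] by multiples of [r] and of [1 - r]; on each half of the interval one of these is at
    most twice the same multiple of [r * (1 - r)], hence the doubled constant. *)
Lemma reaction_bounds (f : R -> R) : admissible_reaction f ->
  exists df L, (forall r, 0 < r < 1 -> is_derive f r (df r)) /\
    (forall r, 0 < r < 1 -> Rabs (df r) <= L) /\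
    (forall r, 0 < r < 1 -> f r <= L * (r * (1 - r))).
Proof.
  intros [[df [Hd Hc]] [H0 [H1 Hpos]]].
  assert (Hder : forall r, 0 < r < 1 -> is_derive f r (df r)).
  { intros r Hr. apply (is_derive_within_interior unit_interval); [|apply Hd].
    - assert (Hmin : 0 < Rmin r (1 - r)) by (apply Rmin_pos; lra).
      exists (mkposreal _ Hmin). intros y Hy.
      change (Rabs (y - r) < Rmin r (1 - r)) in Hy. apply Rabs_def2 in Hy.
      pose proof (Rmin_l r (1 - r)). pose proof (Rmin_r r (1 - r)).
      unfold unit_interval. lra.
    - unfold unit_interval. lra. }
  assert (Hb : exists L, forall r, 0 < r < 1 -> Rabs (df r) <= L).
  { destruct (compact_uniform (fun r _ e => Rabs (df r) <= / e) 0 1 0 0) as [e [He1 He2]].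
    - intros x _ e e' He Hx. apply Rle_trans with (1 := Hx). apply Rinv_le_contravar; lra.
    - intros x y Hx _.
      destruct (proj1 (filterlim_locally _ _) (Hc x Hx) (mkposreal 1 Rlt_0_1)) as [d Hd'].
      set (B := Rabs (df x) + 1).
      assert (HB : 0 < B) by (pose proof (Rabs_pos (df x)); unfold B; lra).
      exists (Rmin d (/ B)).
      assert (Hmin : 0 < Rmin d (/ B))
        by (apply Rmin_pos; [apply cond_pos|now apply Rinv_0_lt_compat]).
      split; [easy|]. intros x' _ Hx' _ Hxx _.
      apply Rle_trans with B.
      + specialize (Hd' x' (Rlt_le_trans _ _ _ Hxx (Rmin_l _ _)) Hx').
        change (Rabs (df x' - df x) < 1) in Hd'.
        pose proof (Rabs_triang (df x' - df x) (df x)) as Ht.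
        replace (df x' - df x + df x) with (df x') in Ht by ring. unfold B. lra.
      + apply Rle_trans with (/ / B); [rewrite Rinv_inv; apply Rle_refl|].
        apply Rinv_le_contravar; [easy|apply Rmin_r].
    - exists (/ e). intros r Hr. apply (He2 r 0); lra. }
  destruct Hb as [L HL]. exists df, (2 * L).
  assert (HLpos : 0 <= L) by (pose proof (HL (1 / 2)); pose proof (Rabs_pos (df (1 / 2))); lra).
  assert (Hmono : forall r s, 0 < r -> r <= s -> s < 1 -> Rabs (f s - f r) <= L * (s - r)).
  { intros r s Hr Hrs Hs. apply Rabs_le. split.
    - enough (f r + L * r <= f s + L * s) by lra.
      apply (derive_nonneg_nondecreasing (fun t => f t + L * t) (fun t => df t + L)); [easy| |].
      + intros t Ht. apply (is_derive_plus f (fun t => L * t)); [apply Hder; lra|].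
        auto_derive; [easy|ring].
      + intros t Ht. specialize (HL t ltac:(lra)). apply Rabs_le_between in HL. lra.
    - enough (L * r - f r <= L * s - f s) by lra.
      apply (derive_nonneg_nondecreasing (fun t => L * t - f t) (fun t => L - df t)); [easy| |].
      + intros t Ht. apply (is_derive_minus (fun t => L * t) f); [|apply Hder; lra].
        auto_derive; [easy|ring].
      + intros t Ht. specialize (HL t ltac:(lra)). apply Rabs_le_between in HL. lra. }
  assert (Hvanish : forall z, unit_interval z -> f z = 0 -> forall eta, 0 < eta ->
    exists d, 0 < d /\ forall y, unit_interval y -> Rabs (y - z) < d -> f y <= eta).
  { intros z Hz Hfz eta Heta.
    destruct (is_derive_within_Lipschitz_at _ _ _ _ Hz (Hd z Hz)) as [d [Hd1 Hd2]].
    set (B := Rabs (df z) + 1) in *.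
    assert (HB : 0 < B) by (pose proof (Rabs_pos (df z)); unfold B; lra).
    exists (Rmin d (eta / B)). split; [apply Rmin_pos; [easy|now apply Rdiv_lt_0_compat]|].
    intros y Hy Hyz. specialize (Hd2 y Hy (Rlt_le_trans _ _ _ Hyz (Rmin_l _ _))).
    pose proof (Rlt_le_trans _ _ _ Hyz (Rmin_r _ _)) as Hyz'.
    apply <- Rlt_div_r in Hyz'; [|lra].
    rewrite Hfz, Rminus_0_r in Hd2. pose proof (Rle_abs (f y)). lra. }
  split; [easy|]. split; [intros r Hr; specialize (HL r Hr); lra|].
  intros r Hr.
  assert (Hleft : f r <= L * r).
  (* [Hmono] holds only inside the open interval, so the endpoint is approached: [c] is close enough
     to 0 for [f c <= eta]. *)
  { apply le_epsilon. intros eta Heta.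
    destruct (Hvanish 0) with (eta := eta) as [d [Hd1 Hd2]]; [unfold unit_interval; lra|easy|easy|].
    set (c := Rmin (d / 2) r). assert (Hc0 : 0 < c) by (apply Rmin_pos; lra).
    assert (Hcd : c <= d / 2) by apply Rmin_l. assert (Hcr : c <= r) by apply Rmin_r.
    specialize (Hd2 c ltac:(unfold unit_interval; lra) ltac:(apply Rabs_def1; lra)).
    pose proof (Hmono c r Hc0 Hcr ltac:(lra)) as Hm. apply Rabs_le_between in Hm. nra. }
  assert (Hright : f r <= L * (1 - r)).
  { apply le_epsilon. intros eta Heta.
    destruct (Hvanish 1) with (eta := eta) as [d [Hd1 Hd2]]; [unfold unit_interval; lra|easy|easy|].
    set (c := Rmin (d / 2) (1 - r)). assert (Hc0 : 0 < c) by (apply Rmin_pos; lra).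
    assert (Hcd : c <= d / 2) by apply Rmin_l. assert (Hcr : c <= 1 - r) by apply Rmin_r.
    specialize (Hd2 (1 - c) ltac:(unfold unit_interval; lra) ltac:(apply Rabs_def1; lra)).
    pose proof (Hmono r (1 - c) ltac:(lra) ltac:(lra) ltac:(lra)) as Hm.
    apply Rabs_le_between in Hm. nra. }
  destruct (Rle_lt_dec r (1 / 2)) as [Hh|Hh].
  - apply Rle_trans with (1 := Hleft). assert (r <= 2 * (r * (1 - r))) by nra. nra.
  - apply Rle_trans with (1 := Hright). assert (1 - r <= 2 * (r * (1 - r))) by nra. nra.
Qed.

(** * Differential calculus of the flux *)

Section Flux.

Context (omega : R -> Rbar) (a a_u a_s : R * R -> R).
Context (Homega : admissible_domain omega) (Ha : admissible_flux omega a)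
  (a_derive : forall u s, Omega omega (u, s) ->
     is_derive_within (fun v => Omega omega (v, s)) (fun v => a (v, s)) u (a_u (u, s)) /\
     is_derive (fun r => a (u, r)) s (a_s (u, s)))
  (a_u_cont : continuous_on (Omega omega) a_u)
  (a_s_cont : continuous_on (Omega omega) a_s)
  (a_s_pos : forall u s, Omega omega (u, s) -> 0 < a_s (u, s)).

Local Lemma Omega_iff u s :
  Omega omega (u, s) <-> 0 <= u <= 1 /\ Rbar_lt (Rabs s) (omega u).
Proof.
  unfold Omega, unit_interval; simpl.
  destruct (omega u) as [w| |]; simpl; try easy.
  split; intros [Hu H]; (split; [easy|]).
  - apply Rabs_def1; lra.
  - apply Rabs_def2 in H; lra.
Qed.

Local Lemma Omega_shrink u s s' :
  Omega omega (u, s) -> Rabs s' <= Rabs s -> Omega omega (u, s').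
Proof.
  rewrite !Omega_iff. intros [Hu H] Hs. split; [easy|].
  destruct (omega u) as [w| |]; simpl in *; try easy. lra.
Qed.

Local Lemma Omega_zero u : 0 <= u <= 1 -> Omega omega (u, 0).
Proof.
  intros Hu. apply Omega_iff. split; [easy|]. rewrite Rabs_R0. now apply Homega.
Qed.

Local Lemma Omega_open u s : Omega omega (u, s) ->
  exists delta, 0 < delta /\ forall u' s', 0 <= u' <= 1 ->
    Rabs (u' - u) < delta -> Rabs (s' - s) < delta -> Omega omega (u', s').
Proof.
  intros H. apply Omega_iff in H. destruct H as [Hu Hs].
  assert (Hy : exists y : R, Rabs s < y /\ Rbar_lt y (omega u)).
  { destruct (omega u) as [w| |]; simpl in *; try easy.
    - exists ((Rabs s + w) / 2). lra.
    - exists (Rabs s + 1). split; [lra|easy]. }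
  destruct Hy as [y [Hy1 Hy2]].
  destruct (proj2 Homega u Hu y Hy2) as [d Hd].
  assert (Hmin : 0 < Rmin d (y - Rabs s)) by (apply Rmin_pos; [apply cond_pos|lra]).
  exists (Rmin d (y - Rabs s)). split; [easy|].
  intros u' s' Hu' H1 H2. apply Omega_iff. split; [easy|].
  apply Rbar_lt_trans with y.
  - simpl. pose proof (Rmin_r d (y - Rabs s)).
    pose proof (Rabs_triang (s' - s) s).
    replace (s' - s + s) with s' in * by lra. lra.
  - apply Hd; [|easy]. apply (Rlt_le_trans _ _ _ H1), Rmin_l.
Qed.

Local Lemma Omega_cont (b : R * R -> R) u s :
  continuous_on (Omega omega) b -> Omega omega (u, s) ->
  forall eps, 0 < eps -> exists delta, 0 < delta /\
    forall u' s', Omega omega (u', s') -> Rabs (u' - u) < delta ->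
      Rabs (s' - s) < delta -> Rabs (b (u', s') - b (u, s)) < eps.
Proof.
  intros Hb HD eps Heps.
  destruct (proj1 (filterlim_locally b (b (u, s))) (Hb _ HD) (mkposreal eps Heps))
    as [d Hd].
  exists d. split; [apply cond_pos|]. intros u' s' HD' H1 H2.
  apply (Hd (u', s')); [|easy]. split; easy.
Qed.

Local Lemma Omega_cont_comp (b : R * R -> R) (U q : R -> R) t :
  continuous_on (Omega omega) b -> continuous U t -> continuous q t ->
  (forall y, Omega omega (U y, q y)) -> continuous (fun y => b (U y, q y)) t.
Proof.
  intros Hb HU Hq HD. apply continuous_eps_delta. intros eps Heps.
  destruct (Omega_cont b (U t) (q t) Hb (HD t) eps Heps) as [d [Hd1 Hd2]].
  destruct (proj1 (continuous_eps_delta _ _) HU d Hd1) as [d1 [Hd11 Hd12]].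
  destruct (proj1 (continuous_eps_delta _ _) Hq d Hd1) as [d2 [Hd21 Hd22]].
  exists (Rmin d1 d2). split; [now apply Rmin_pos|]. intros y Hy.
  apply Hd2; [apply HD| |].
  - apply Hd12. apply (Rlt_le_trans _ _ _ Hy), Rmin_l.
  - apply Hd22. apply (Rlt_le_trans _ _ _ Hy), Rmin_r.
Qed.

Local Lemma flux_zero u : 0 <= u <= 1 -> a (u, 0) = 0.
Proof.
  intros Hu. destruct Ha as [_ [Hodd _]].
  specialize (Hodd u 0 (Omega_zero u Hu)). rewrite Ropp_0 in Hodd. lra.
Qed.

Local Lemma flux_increment m M u p1 p2 :
  Omega omega (u, p2) -> 0 <= p1 <= p2 ->
  (forall p, 0 <= p <= p2 -> m <= a_s (u, p) <= M) ->
  m * (p2 - p1) <= a (u, p2) - a (u, p1) <= M * (p2 - p1).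
Proof.
  intros HD Hp Hm.
  assert (Hder : forall p, p1 <= p <= p2 -> is_derive (fun r => a (u, r)) p (a_s (u, p))).
  { intros p Hp'. apply a_derive. apply (Omega_shrink u p2); [easy|].
    rewrite !Rabs_pos_eq; lra. }
  split.
  - enough (a (u, p1) - m * p1 <= a (u, p2) - m * p2) by lra.
    apply (derive_nonneg_nondecreasing (fun p => a (u, p) - m * p)
      (fun p => a_s (u, p) - m)); [lra| |].
    + intros p Hp'. apply (is_derive_minus (fun r => a (u, r)) (fun r => m * r)).
      * now apply Hder.
      * auto_derive; [easy|lra].
    + intros p Hp'. specialize (Hm p). lra.
  - enough (M * p1 - a (u, p1) <= M * p2 - a (u, p2)) by lra.
    apply (derive_nonneg_nondecreasing (fun p => M * p - a (u, p))
      (fun p => M - a_s (u, p))); [lra| |].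
    + intros p Hp'. apply (is_derive_minus (fun r => M * r) (fun r => a (u, r))).
      * auto_derive; [easy|lra].
      * now apply Hder.
    + intros p Hp'. specialize (Hm p). lra.
Qed.

(** Slope functions in two variables. The increment splits into a move of [U] with [q t] fixed and a
    move of [q] at the displaced [U y]; the mean value theorem and the continuity of [a_s] make the
    second quotient continuous. Since [q] is only continuous here, the lemma serves the chain rule
    as well as its converse. The condition [0 < U t < 1] turns the relative derivative in [u] into a
    two-sided one. *)
Local Lemma flux_slopes (U q : R -> R) t dU :
  is_derive U t dU -> continuous q t -> 0 < U t < 1 -> Omega omega (U t, q t) ->
  exists A B : R -> R, continuous A t /\ continuous B t /\
    A t = a_u (U t, q t) /\ B t = a_s (U t, q t) /\
    locally t (fun y => a (U y, q y) - a (U t, q t)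
      = A y * (U y - U t) + B y * (q y - q t)).
Proof.
  intros HdU Hq HU HD.
  assert (HcU : continuous U t) by (apply (ex_derive_continuous U); now exists dU).
  destruct (Omega_open _ _ HD) as [d0 [Hd0 Hopen]].
  assert (HUloc : forall r, 0 < r -> locally t (fun y => Rabs (U y - U t) < r)).
  { intros r Hr. destruct (proj1 (continuous_eps_delta _ _) HcU r Hr) as [d [Hd1 Hd2]].
    exists (mkposreal d Hd1). intros y Hy. now apply Hd2. }
  assert (Hqloc : forall r, 0 < r -> locally t (fun y => Rabs (q y - q t) < r)).
  { intros r Hr. destruct (proj1 (continuous_eps_delta _ _) Hq r Hr) as [d [Hd1 Hd2]].
    exists (mkposreal d Hd1). intros y Hy. now apply Hd2. }
  assert (Hunit : locally t (fun y => 0 <= U y <= 1)).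
  { generalize (HUloc (Rmin (U t) (1 - U t)) ltac:(apply Rmin_pos; lra)).
    apply filter_imp. intros y Hy.
    pose proof (Rmin_l (U t) (1 - U t)). pose proof (Rmin_r (U t) (1 - U t)).
    apply Rabs_def2 in Hy. lra. }
  assert (Hu : is_derive (fun v => a (v, q t)) (U t) (a_u (U t, q t))).
  { apply (is_derive_within_interior (fun v => Omega omega (v, q t))).
    - assert (Hr : 0 < Rmin d0 (Rmin (U t) (1 - U t))) by (repeat apply Rmin_pos; lra).
      exists (mkposreal _ Hr). intros v Hv.
      change (Rabs (v - U t) < Rmin d0 (Rmin (U t) (1 - U t))) in Hv.
      pose proof (Rmin_l (U t) (1 - U t)). pose proof (Rmin_r (U t) (1 - U t)).
      pose proof (Rmin_l d0 (Rmin (U t) (1 - U t))).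
      pose proof (Rmin_r d0 (Rmin (U t) (1 - U t))).
      apply Hopen; [|lra|now rewrite Rminus_diag, Rabs_R0].
      apply Rabs_def2 in Hv. lra.
    - now apply a_derive. }
  destruct (proj1 (is_derive_slope _ _ _) Hu) as [phi [Hphi1 [Hphi2 Hphi3]]].
  set (B := fun y => if Req_EM_T (q y) (q t) then a_s (U y, q t)
    else (a (U y, q y) - a (U y, q t)) / (q y - q t)).
  assert (HB : forall r, 0 < r -> r <= d0 -> locally t (fun y => exists th,
    Omega omega (U y, th) /\ Rabs (th - q t) < r /\ Rabs (U y - U t) < r /\
    B y = a_s (U y, th))).
  { intros r Hr Hrd.
    generalize (filter_and _ _ (HUloc r Hr) (filter_and _ _ (Hqloc r Hr) Hunit)).
    apply filter_imp. intros y [H1 [H2 H3]].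
    assert (Hseg : forall th, Rabs (th - q t) < r -> Omega omega (U y, th)).
    { intros th Hth. apply Hopen; [easy| |]; lra. }
    unfold B. destruct (Req_EM_T (q y) (q t)) as [Heq|Hne].
    - exists (q t). rewrite Rminus_diag, Rabs_R0.
      split; [|now repeat split]. apply Hseg. now rewrite Rminus_diag, Rabs_R0.
    - destruct (MVT_gen (fun p => a (U y, p)) (q t) (q y) (fun p => a_s (U y, p)))
        as [th [Hth1 Hth2]].
      + intros p Hp. apply a_derive, Hseg. apply Rabs_def2 in H2. apply Rabs_def1;
        revert Hp; unfold Rmin, Rmax; destruct (Rle_dec (q t) (q y)); lra.
      + intros p Hp. apply continuity_pt_filterlim.
        apply (ex_derive_continuous (fun p => a (U y, p))). eexists. apply a_derive, Hseg.
        apply Rabs_def2 in H2. apply Rabs_def1;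
        revert Hp; unfold Rmin, Rmax; destruct (Rle_dec (q t) (q y)); lra.
      + assert (Hth : Rabs (th - q t) < r).
        { apply Rabs_def2 in H2. apply Rabs_def1;
          revert Hth1; unfold Rmin, Rmax; destruct (Rle_dec (q t) (q y)); lra. }
        exists th. repeat split; try easy; try (now apply Hseg).
        rewrite Hth2. field. lra. }
  exists (fun y => phi (U y)), B. repeat split.
  - now apply continuous_comp.
  - assert (HBt : B t = a_s (U t, q t)).
    { unfold B. destruct (Req_EM_T (q t) (q t)); easy. }
    apply continuous_eps_delta. intros eps Heps.
    destruct (Omega_cont a_s _ _ a_s_cont HD eps Heps) as [d [Hd1 Hd2]].
    destruct (HB (Rmin d d0) ltac:(now apply Rmin_pos) ltac:(apply Rmin_r)) as [d1 Hd11].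
    exists d1. split; [apply cond_pos|]. intros y Hy.
    destruct (Hd11 y Hy) as [th [HDth [H1 [H2 ->]]]]. rewrite HBt.
    pose proof (Rmin_l d d0). apply Hd2; [easy|lra|lra].
  - easy.
  - unfold B. destruct (Req_EM_T (q t) (q t)); easy.
  - assert (Hphi4 : locally t (fun y => a (U y, q t) - a (U t, q t)
      = phi (U y) * (U y - U t))).
    { exact (HcU _ Hphi3). }
    revert Hphi4. apply filter_imp. intros y Hy.
    replace (a (U y, q y) - a (U t, q t))
      with (a (U y, q t) - a (U t, q t) + (a (U y, q y) - a (U y, q t))) by lra.
    rewrite Hy. f_equal. unfold B.
    destruct (Req_EM_T (q y) (q t)) as [->|Hne]; [lra|field; lra].
Qed.

Local Lemma flux_chain_rule (U q : R -> R) t dU dq :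
  is_derive U t dU -> is_derive q t dq -> 0 < U t < 1 -> Omega omega (U t, q t) ->
  is_derive (fun y => a (U y, q y)) t (a_u (U t, q t) * dU + a_s (U t, q t) * dq).
Proof.
  intros HdU Hdq HU HD.
  destruct (flux_slopes U q t dU) as [A [B [HA [HB [HAt [HBt Hab]]]]]]; try easy.
  { apply (ex_derive_continuous q). now exists dq. }
  destruct (proj1 (is_derive_slope _ _ _) HdU) as [pU [HpU1 [HpU2 HpU3]]].
  destruct (proj1 (is_derive_slope _ _ _) Hdq) as [pq [Hpq1 [Hpq2 Hpq3]]].
  apply is_derive_slope. exists (fun y => A y * pU y + B y * pq y). split; [|split].
  - apply (continuous_plus (fun y => A y * pU y) (fun y => B y * pq y)).
    + now apply (continuous_mult A pU).
    + now apply (continuous_mult B pq).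
  - now rewrite HAt, HBt, HpU2, Hpq2.
  - generalize (filter_and _ _ Hab (filter_and _ _ HpU3 Hpq3)).
    apply filter_imp. intros y [-> [-> ->]]. lra.
Qed.

(** The slope identity is solved for the increment of [q], whose coefficient [B] is positive at [t]
    and so nonzero nearby. This recovers the second derivative of a profile from the derivative of
    its flux. *)
Local Lemma flux_implicit (U q : R -> R) t dU dW :
  is_derive U t dU -> continuous q t -> 0 < U t < 1 -> Omega omega (U t, q t) ->
  is_derive (fun y => a (U y, q y)) t dW ->
  is_derive q t ((dW - a_u (U t, q t) * dU) / a_s (U t, q t)).
Proof.
  intros HdU Hq HU HD HdW.
  destruct (flux_slopes U q t dU) as [A [B [HA [HB [HAt [HBt Hab]]]]]]; try easy.
  destruct (proj1 (is_derive_slope _ _ _) HdU) as [pU [HpU1 [HpU2 HpU3]]].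
  destruct (proj1 (is_derive_slope _ _ _) HdW) as [pW [HpW1 [HpW2 HpW3]]].
  assert (HBpos : 0 < B t) by (rewrite HBt; now apply a_s_pos).
  apply is_derive_slope. exists (fun y => (pW y - A y * pU y) * / B y).
  split; [|split].
  - apply (continuous_mult (fun y => pW y - A y * pU y) (fun y => / B y)).
    + apply (continuous_minus pW (fun y => A y * pU y)); [easy|].
      now apply (continuous_mult A pU).
    + apply continuous_Rinv_comp; [easy|lra].
  - now rewrite HAt, HBt, HpU2, HpW2.
  - assert (HBl : locally t (fun y => B y <> 0)).
    { destruct (proj1 (continuous_eps_delta _ _) HB (B t) HBpos) as [d [Hd1 Hd2]].
      exists (mkposreal d Hd1). intros y Hy. specialize (Hd2 y Hy).
      apply Rabs_def2 in Hd2. lra. }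
    generalize (filter_and _ _ HBl (filter_and _ _ Hab (filter_and _ _ HpU3 HpW3))).
    apply filter_imp. intros y [H1 [H2 [H3 H4]]].
    rewrite H4, H3 in H2.
    replace ((pW y - A y * pU y) * / B y * (y - t))
      with ((pW y * (y - t) - A y * (pU y * (y - t))) / B y) by (field; easy).
    rewrite H2. field. easy.
Qed.

(** * From a barrier to a wave *)

Section Barrier.

Context (f df : R -> R) (L : R) (sigma : R) (u P dV : R -> R) (m M : R).
Context
  (f_derive : forall r, 0 < r < 1 -> is_derive f r (df r))
  (df_bound : forall r, 0 < r < 1 -> Rabs (df r) <= L)
  (f_pos : forall r, 0 < r < 1 -> 0 < f r)
  (f_bound : forall r, 0 < r < 1 -> f r <= L * (r * (1 - r)))
  (u_derive : forall x, is_derive u x (P x))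
  (P_pos : forall x, 0 < P x) (P_cont : forall x, continuous P x)
  (u_range : forall x, 0 < u x < 1)
  (u_lim0 : is_lim u m_infty 0) (u_lim1 : is_lim u p_infty 1)
  (u_Omega : forall x, Omega omega (u x, P x))
  (V_derive : forall x, is_derive (fun y => a (u y, P y)) x (dV x))
  (V_super : forall x, dV x <= sigma * P x - f (u x))
  (m_pos : 0 < m)
  (a_s_bounds : forall x p, 0 <= p <= P x -> m <= a_s (u x, p) <= M).

Let V (x : R) := a (u x, P x).
(** Chosen for [kappa_small]: the cap 1 gives [kappa * L <= L], and the [+ 1] makes the inequality
    strict. *)
Let kappa := Rmin 1 (m / (Rabs sigma + L + 1)).
Let lower (x : R) := kappa * f (u x).
Let slope (x w : R) := epsilon (inhabits 0) (fun p => 0 <= p <= P x /\ a (u x, p) = w).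
Let field (x w : R) := (sigma - f (u x) / slope x w) * P x.
(** Between the curves, the first summand makes [rate x * w - field x w] nondecreasing in [w]; the
    second makes [rate x * lower x >= sigma * P x], so that this difference is also nonnegative. *)
Let Q := M * M / (m * kappa * kappa) + Rabs sigma / kappa.
Let rate (x : R) := Q * (P x / f (u x)).
Let Lam (x : R) := RInt rate 0 x.

Local Lemma L_nonneg : 0 <= L.
Proof. pose proof (Rabs_pos (df (1 / 2))). pose proof (df_bound (1 / 2)). lra. Qed.

Local Lemma Omega_below x p : 0 <= p <= P x -> Omega omega (u x, p).
Proof.
  intros Hp. apply (Omega_shrink _ (P x)); [easy|]. rewrite !Rabs_pos_eq; lra.
Qed.

Local Lemma increment x p1 p2 : 0 <= p1 <= p2 -> p2 <= P x ->
  m * (p2 - p1) <= a (u x, p2) - a (u x, p1) <= M * (p2 - p1).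
Proof.
  intros H1 H2. apply flux_increment; [apply Omega_below; lra|easy|].
  intros p Hp. apply a_s_bounds. lra.
Qed.

Local Lemma flux_bounds x p : 0 <= p <= P x -> m * p <= a (u x, p) <= M * p.
Proof.
  intros Hp. pose proof (increment x 0 p) as H. specialize (u_range x) as Hu.
  rewrite flux_zero in H by lra. lra.
Qed.

Local Lemma kappa_pos : 0 < kappa.
Proof.
  pose proof L_nonneg. pose proof (Rabs_pos sigma).
  apply Rmin_pos; [lra|]. apply Rdiv_lt_0_compat; lra.
Qed.

Local Lemma kappa_small : kappa * (Rabs sigma + kappa * L) < m.
Proof.
  pose proof L_nonneg. pose proof (Rabs_pos sigma). pose proof kappa_pos.
  assert (Hk1 : kappa <= 1) by apply Rmin_l.
  assert (Hk2 : kappa <= m / (Rabs sigma + L + 1)) by apply Rmin_r.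
  apply <- Rle_div_r in Hk2; [|lra].
  assert (kappa * L <= L) by nra. nra.
Qed.

Local Lemma M_pos : 0 < M.
Proof. pose proof (a_s_bounds 0 0). pose proof (P_pos 0). lra. Qed.

Local Lemma V_pos x : 0 < V x.
Proof.
  pose proof (flux_bounds x (P x)). pose proof (P_pos x). unfold V. nra.
Qed.

Local Lemma lower_derive x : is_derive lower x (kappa * (df (u x) * P x)).
Proof.
  apply is_derive_scal. rewrite Rmult_comm.
  apply (is_derive_comp f u); [now apply f_derive|apply u_derive].
Qed.

(** Here [p <= kappa * f (u x) / m], so [f (u x) / p] is at least [m / kappa], which exceeds [sigma]
    by more than [kappa * L], a bound for [kappa * df]. Allowing any such [p] covers both the slope
    on the lower curve and [P x] at points where [V] lies below that curve. *)
Local Lemma field_at_lower x p : 0 < p -> m * p <= lower x ->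
  (sigma - f (u x) / p) * P x < kappa * (df (u x) * P x).
Proof.
  intros Hp Hw. unfold lower in Hw.
  pose proof (f_pos _ (u_range x)). pose proof (P_pos x). pose proof kappa_pos.
  pose proof kappa_small as Hk.
  pose proof (df_bound _ (u_range x)) as Hdf. apply Rabs_le_between in Hdf.
  pose proof (Rle_abs sigma) as Hs.
  assert (Hfp : m / kappa <= f (u x) / p).
  { apply -> Rle_div_r; [|lra].
    replace (m / kappa * p) with (m * p / kappa) by (unfold Rdiv; ring).
    apply <- Rle_div_l; lra. }
  assert (Hmk : Rabs sigma + kappa * L < m / kappa) by (apply -> Rlt_div_r; lra).
  rewrite <- Rmult_assoc. apply Rmult_lt_compat_r; [easy|].
  assert (- (kappa * L) <= kappa * df (u x)) by nra. lra.
Qed.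

Local Lemma lower_bound_small eps : 0 < eps -> exists X, forall x, X < x -> lower x < eps.
Proof.
  intros Heps. pose proof kappa_pos. pose proof L_nonneg.
  apply is_lim_spec in u_lim1.
  assert (He : 0 < eps / (kappa * L + 1)).
  { apply Rdiv_lt_0_compat; [easy|]. assert (0 <= kappa * L) by nra. lra. }
  destruct (u_lim1 (mkposreal _ He)) as [X HX]. exists X. intros x Hx.
  specialize (HX x Hx). simpl in HX. apply Rabs_def2 in HX.
  pose proof (u_range x) as Hu. pose proof (f_bound _ Hu).
  assert (Hu1 : 1 - u x < eps / (kappa * L + 1)) by lra.
  assert (Hkl : 0 <= kappa * L) by nra.
  apply <- Rlt_div_r in Hu1; [|lra].
  assert (L * (u x * (1 - u x)) <= L * (1 - u x)).
  { apply Rmult_le_compat_l; [easy|]. nra. }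
  unfold lower. assert (kappa * f (u x) <= kappa * (L * (1 - u x))) by nra. nra.
Qed.

(* The curve [lower] is repelling: once [V] is below it, [V - lower] keeps
   decreasing, which contradicts [V > 0] and [lower -> 0]. *)
Local Lemma lower_le_V x : lower x <= V x.
Proof.
  destruct (Rle_lt_dec (lower x) (V x)) as [Hle|Hlt]; [easy|exfalso].
  set (D := fun y => V y - lower y).
  assert (HD : forall y, is_derive D y (dV y - kappa * (df (u y) * P y))).
  { intros y. apply (is_derive_minus V lower); [apply V_derive|apply lower_derive]. }
  assert (Hdec : forall y, D y < 0 -> dV y - kappa * (df (u y) * P y) < 0).
  { intros y Hy. unfold D in Hy. pose proof (P_pos y).
    pose proof (flux_bounds y (P y)).
    pose proof (field_at_lower y (P y)) as Hf. unfold V in Hy.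
    replace ((sigma - f (u y) / P y) * P y) with (sigma * P y - f (u y)) in Hf
      by (field; lra).
    pose proof (V_super y). lra. }
  destruct (lower_bound_small (lower x - V x)) as [Y HY]; [lra|].
  set (y := Rmax x (Y + 1)).
  assert (Hxy : x <= y) by apply Rmax_l.
  assert (HYy : Y < y) by (pose proof (Rmax_r x (Y + 1)); unfold y; lra).
  specialize (HY y HYy).
  destruct (continuity_ab_min D x y Hxy) as [z [Hz1 Hz2]].
  { intros c _. apply continuity_pt_filterlim.
    apply (ex_derive_continuous D). eexists; apply HD. }
  assert (HDz : D z <= D x) by (apply Hz1; lra).
  assert (HDx : D x < 0) by (unfold D; lra).
  assert (HDz0 : D z < 0) by lra.
  destruct (Req_dec z y) as [Heq|Hne].
  - rewrite Heq in HDz. unfold D in HDz. pose proof (V_pos y). lra.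
  - destruct (derive_neg_decreases D z _ (y - z) (HD z) (Hdec z HDz0)) as [h [Hh1 Hh2]];
      [lra|].
    pose proof (Hz1 (z + h) ltac:(lra)). lra.
Qed.

Local Lemma lower_pos x : 0 < lower x.
Proof. apply Rmult_lt_0_compat; [apply kappa_pos|]. now apply f_pos. Qed.

Local Lemma slope_spec x w : 0 <= w <= V x ->
  0 <= slope x w <= P x /\ a (u x, slope x w) = w.
Proof.
  intros Hw. unfold slope.
  apply (epsilon_spec (inhabits 0) (fun p => 0 <= p <= P x /\ a (u x, p) = w)).
  pose proof (u_range x) as Hu.
  apply (exists_preimage (fun p => a (u x, p))).
  - apply Rlt_le, P_pos.
  - intros p Hp. apply (ex_derive_continuous (fun p => a (u x, p))). eexists.
    apply a_derive. now apply Omega_below.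
  - rewrite flux_zero by lra. exact Hw.
Qed.

Local Lemma slope_bounds x w : lower x <= w <= V x ->
  0 < slope x w <= P x /\ a (u x, slope x w) = w /\
  m * slope x w <= w <= M * slope x w.
Proof.
  intros Hw. pose proof (lower_pos x).
  destruct (slope_spec x w) as [H1 H2]; [lra|].
  pose proof (flux_bounds x _ H1) as H3. rewrite H2 in H3.
  pose proof M_pos. repeat split; try easy; try lra. nra.
Qed.

(** The slope at [y] is compared with [q y], the slope at [x] truncated to stay in [[0, P y]], where
    the bound [m] on [a_s] is available. Their distance is at most [1 / m] times
    [w y - a (u y, q y)] in absolute value, a continuous quantity that vanishes at [x]. *)
Local Lemma slope_continuous (w : R -> R) :
  (forall x, continuous w x) -> (forall x, lower x <= w x <= V x) ->
  forall x, continuous (fun y => slope y (w y)) x.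
Proof.
  intros Hwc Hw x. destruct (slope_bounds x (w x) (Hw x)) as [Hp [Hap _]].
  set (q := fun y => Rmin (slope x (w x)) (P y)).
  assert (Hqx : q x = slope x (w x)) by (apply Rmin_left; lra).
  assert (Hqc : forall y, continuous q y).
  { intros y. apply continuous_eps_delta. intros eps Heps.
    destruct (proj1 (continuous_eps_delta _ _) (P_cont y) eps Heps) as [d [Hd1 Hd2]].
    exists d. split; [easy|]. intros y' Hy'. specialize (Hd2 y' Hy').
    apply Rabs_def2 in Hd2. unfold q, Rmin.
    destruct (Rle_dec _ (P y')), (Rle_dec _ (P y)); apply Rabs_def1; lra. }
  assert (Hqr : forall y, 0 <= q y <= P y).
  { intros y. pose proof (P_pos y). split; [|apply Rmin_r]. apply Rmin_glb; lra. }
  assert (Hgap : continuous (fun y => w y - a (u y, q y)) x).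
  { apply (continuous_minus w (fun y => a (u y, q y))); [apply Hwc|].
    apply Omega_cont_comp; [apply Ha| |apply Hqc|].
    - apply (ex_derive_continuous u). eexists; apply u_derive.
    - intros y. now apply Omega_below. }
  apply continuous_eps_delta. intros eps Heps.
  destruct (proj1 (continuous_eps_delta _ _) Hgap (m * eps / 2)) as [d1 [Hd11 Hd12]].
  { apply Rdiv_lt_0_compat; [|lra]. now apply Rmult_lt_0_compat. }
  destruct (proj1 (continuous_eps_delta _ _) (Hqc x) (eps / 2)) as [d2 [Hd21 Hd22]]; [lra|].
  exists (Rmin d1 d2). split; [now apply Rmin_pos|]. intros y Hy.
  assert (Hy1 : Rabs (y - x) < d1) by (apply (Rlt_le_trans _ _ _ Hy), Rmin_l).
  assert (Hy2 : Rabs (y - x) < d2) by (apply (Rlt_le_trans _ _ _ Hy), Rmin_r).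
  specialize (Hd12 y Hy1). specialize (Hd22 y Hy2). cbv beta in Hd12.
  rewrite Hqx, Hap in Hd12. rewrite Hqx in Hd22.
  destruct (slope_bounds y (w y) (Hw y)) as [Hpy [Hapy _]].
  rewrite Rminus_diag, Rminus_0_r in Hd12. rewrite <- Hapy in Hd12 at 1.
  pose proof (Hqr y). apply Rabs_def2 in Hd12. apply Rabs_def2 in Hd22.
  destruct (Rle_lt_dec (q y) (slope y (w y))) as [Hle|Hlt].
  - pose proof (increment y (q y) (slope y (w y))) as Hi.
    assert (slope y (w y) - q y < eps / 2) by nra. apply Rabs_def1; lra.
  - pose proof (increment y (slope y (w y)) (q y)) as Hi.
    assert (q y - slope y (w y) < eps / 2) by nra. apply Rabs_def1; lra.
Qed.

Local Lemma u_cont x : continuous u x.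
Proof. apply (ex_derive_continuous u). eexists; apply u_derive. Qed.

Local Lemma fu_cont x : continuous (fun y => f (u y)) x.
Proof.
  apply continuous_comp; [apply u_cont|].
  apply (ex_derive_continuous f). eexists. now apply f_derive.
Qed.

Local Lemma rate_cont x : continuous rate x.
Proof.
  apply (continuous_mult (fun _ => Q) (fun y => P y / f (u y))).
  - apply continuous_const.
  - apply (continuous_mult P (fun y => / f (u y))); [apply P_cont|].
    apply continuous_Rinv_comp; [apply fu_cont|]. pose proof (f_pos _ (u_range x)). lra.
Qed.

Local Lemma Lam_derive x : is_derive Lam x (rate x).
Proof.
  apply (is_derive_RInt rate Lam 0 x); [|apply rate_cont].
  apply filter_forall. intros y. apply (RInt_correct rate 0 y), (ex_RInt_continuous rate).
  intros; apply rate_cont.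
Qed.

Local Lemma Q_pos : 0 < Q.
Proof.
  pose proof M_pos. pose proof kappa_pos. pose proof (Rabs_pos sigma).
  assert (0 < M * M / (m * kappa * kappa)).
  { apply Rdiv_lt_0_compat; repeat apply Rmult_lt_0_compat; easy. }
  assert (0 <= Rabs sigma / kappa) by (apply Rdiv_le_0_compat; easy). unfold Q. lra.
Qed.

Local Lemma rate_pos x : 0 < rate x.
Proof.
  apply Rmult_lt_0_compat; [apply Q_pos|].
  apply Rdiv_lt_0_compat; [apply P_pos|]. now apply f_pos.
Qed.

Local Lemma Lam_nonneg x : 0 <= x -> 0 <= Lam x.
Proof.
  intros Hx. apply Rle_trans with (Lam 0).
  - unfold Lam. rewrite RInt_point. apply Rle_refl.
  - apply (derive_nonneg_nondecreasing Lam rate); [easy| |].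
    + intros; apply Lam_derive.
    + intros; apply Rlt_le, rate_pos.
Qed.

(** Above the lower curve every slope is at least [c = kappa * f (u x) / M]. So [1 / p] varies with
    [p] at rate at most [1 / (c * c)], and [p] with [w] at rate at most [1 / m]; the product is
    accounted for by the first summand of [Q]. *)
Local Lemma field_one_sided_Lipschitz x w1 w2 :
  lower x <= w1 -> w1 <= w2 -> w2 <= V x ->
  rate x * w1 - field x w1 <= rate x * w2 - field x w2.
Proof.
  intros H1 H12 H2.
  destruct (slope_bounds x w1) as [Hp1 [Ha1 Hb1]]; [lra|].
  destruct (slope_bounds x w2) as [Hp2 [Ha2 Hb2]]; [lra|].
  unfold field, rate.
  set (p1 := slope x w1) in *. set (p2 := slope x w2) in *.
  pose proof (f_pos _ (u_range x)) as Hf. pose proof (P_pos x) as HP.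
  pose proof kappa_pos as Hk. pose proof M_pos as HM.
  assert (Hp12 : p1 <= p2).
  { destruct (Rle_lt_dec p1 p2) as [|Hlt]; [easy|].
    pose proof (increment x p2 p1) as Hi. rewrite Ha1, Ha2 in Hi. nra. }
  assert (Hdp : m * (p2 - p1) <= w2 - w1).
  { pose proof (increment x p1 p2) as Hi. rewrite Ha1, Ha2 in Hi. lra. }
  set (c := kappa * f (u x) / M).
  assert (Hc : 0 < c) by (apply Rdiv_lt_0_compat; [now apply Rmult_lt_0_compat|easy]).
  assert (Hcp : c <= p1).
  { apply <- Rle_div_l; [|lra]. unfold lower in H1. lra. }
  assert (Hdiff : f (u x) / p1 - f (u x) / p2 <= Q / f (u x) * (w2 - w1)).
  { apply Rle_trans with (f (u x) * ((w2 - w1) / m) / (c * c)).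
    - replace (f (u x) / p1 - f (u x) / p2) with (f (u x) * (p2 - p1) / (p1 * p2))
        by (field; lra).
      unfold Rdiv. apply Rmult_le_compat.
      + apply Rmult_le_pos; lra.
      + apply Rlt_le, Rinv_0_lt_compat, Rmult_lt_0_compat; lra.
      + apply Rmult_le_compat_l; [lra|]. apply -> Rle_div_r; lra.
      + apply Rinv_le_contravar; [now apply Rmult_lt_0_compat|].
        apply Rmult_le_compat; lra.
    - replace (f (u x) * ((w2 - w1) / m) / (c * c))
        with (M * M / (m * kappa * kappa) / f (u x) * (w2 - w1))
        by (unfold c; field; lra).
      apply Rmult_le_compat_r; [lra|]. unfold Rdiv at 1 3.
      apply Rmult_le_compat_r; [apply Rlt_le, Rinv_0_lt_compat, Hf|].
      unfold Q. assert (0 <= Rabs sigma / kappa)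
        by (apply Rdiv_le_0_compat; [apply Rabs_pos|easy]). lra. }
  replace (Q * (P x / f (u x)) * w1) with (P x * (Q / f (u x) * w1)) by (field; lra).
  replace (Q * (P x / f (u x)) * w2) with (P x * (Q / f (u x) * w2)) by (field; lra).
  nra.
Qed.

Local Lemma field_le_rate x w : lower x <= w <= V x -> 0 <= rate x * w - field x w.
Proof.
  intros Hw. destruct (slope_bounds x w Hw) as [Hp _].
  pose proof (f_pos _ (u_range x)) as Hf. pose proof (P_pos x) as HP.
  pose proof kappa_pos as Hk. pose proof (rate_pos x).
  assert (H1 : rate x * lower x <= rate x * w) by (apply Rmult_le_compat_l; lra).
  assert (H2 : sigma * P x <= rate x * lower x).
  { unfold rate, lower, Q.
    replace ((M * M / (m * kappa * kappa) + Rabs sigma / kappa) * (P x / f (u x)) *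
      (kappa * f (u x))) with ((M * M / (m * kappa) + Rabs sigma) * P x)
      by (field; lra).
    apply Rmult_le_compat_r; [lra|]. pose proof (Rle_abs sigma).
    assert (0 <= M * M / (m * kappa)); [|lra].
    apply Rdiv_le_0_compat; [apply Rle_0_sqr|now apply Rmult_lt_0_compat]. }
  assert (H3 : 0 <= f (u x) / slope x w) by (apply Rdiv_le_0_compat; lra).
  unfold field. nra.
Qed.

Local Lemma slope_V x : slope x (V x) = P x.
Proof.
  destruct (slope_spec x (V x)) as [H1 H2]; [pose proof (V_pos x); lra|].
  pose proof (increment x (slope x (V x)) (P x)) as Hi.
  rewrite H2 in Hi. unfold V in *. nra.
Qed.

Local Lemma exp_scaled_derive (g : R -> R) dg x : is_derive g x dg ->
  is_derive (fun y => exp (- Lam y) * g y) x (exp (- Lam x) * (dg - rate x * g x)).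
Proof.
  intros Hg.
  replace (exp (- Lam x) * (dg - rate x * g x))
    with ((- rate x * exp (- Lam x)) * g x + exp (- Lam x) * dg) by ring.
  apply (is_derive_mult (fun y => exp (- Lam y)) g); [|easy|intros; apply Rmult_comm].
  apply (is_derive_comp exp (fun y => - Lam y)); [apply is_derive_exp|].
  apply (is_derive_opp Lam), Lam_derive.
Qed.

Local Lemma flux_ode : exists w : R -> R,
  (forall x, lower x <= w x <= V x) /\ forall x, is_derive w x (field x (w x)).
Proof.
  assert (Hexp : forall x r, exp (Lam x) * (exp (- Lam x) * r) = r).
  { intros x r. rewrite <- Rmult_assoc, <- exp_plus, Rplus_opp_r, exp_0. ring. }
  assert (Hscale : forall x z, exp (- Lam x) * lower x <= z <= exp (- Lam x) * V x ->
    lower x <= exp (Lam x) * z <= V x).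
  { intros x z Hz. rewrite <- (Hexp x (lower x)), <- (Hexp x (V x)).
    pose proof (exp_pos (Lam x)). split; apply Rmult_le_compat_l; lra. }
  destruct (monotone_ode_solution
    (fun x z => exp (- Lam x) * (rate x * (exp (Lam x) * z) - field x (exp (Lam x) * z)))
    (fun x => exp (- Lam x) * lower x) (fun x => exp (- Lam x) * V x)
    (fun x => exp (- Lam x) * (kappa * (df (u x) * P x) - rate x * lower x))
    (fun x => exp (- Lam x) * (dV x - rate x * V x))) as [z [Hz1 Hz2]].
  - intros x. apply exp_scaled_derive, lower_derive.
  - intros x. apply (exp_scaled_derive V), V_derive.
  - intros x. apply Rmult_le_pos; apply Rlt_le; [apply exp_pos|apply lower_pos].
  - intros x. apply Rmult_le_compat_l; [apply Rlt_le, exp_pos|apply lower_le_V].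
  - intros x z1 z2 H1 H12 H2. pose proof (exp_pos (Lam x)).
    apply Rmult_le_compat_l; [apply Rlt_le, exp_pos|].
    apply field_one_sided_Lipschitz.
    + apply Hscale. lra.
    + apply Rmult_le_compat_l; lra.
    + apply Hscale. lra.
  - intros x z Hz. apply Rmult_le_pos; [apply Rlt_le, exp_pos|].
    now apply field_le_rate, Hscale.
  - intros z Hzc Hz x.
    assert (HLc : forall y, continuous Lam y)
      by (intros y; apply (ex_derive_continuous Lam); eexists; apply Lam_derive).
    assert (Hec : forall y, continuous exp y)
      by (intros y; apply (ex_derive_continuous exp); eexists; apply is_derive_exp).
    assert (Hwc : forall y, continuous (fun t => exp (Lam t) * z t) y).
    { intros y. apply (continuous_mult (fun t => exp (Lam t)) z); [|apply Hzc].
      now apply continuous_comp. }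
    pose proof (slope_continuous _ Hwc (fun y => Hscale y _ (Hz y))) as Hpc.
    apply (continuous_mult (fun y => exp (- Lam y))
      (fun y => rate y * (exp (Lam y) * z y) - field y (exp (Lam y) * z y))).
    + apply (continuous_comp (fun y => - Lam y) exp); [|apply Hec].
      now apply (continuous_opp Lam).
    + apply (continuous_minus (fun y => rate y * (exp (Lam y) * z y))
        (fun y => field y (exp (Lam y) * z y))).
      * apply (continuous_mult rate (fun y => exp (Lam y) * z y));
          [apply rate_cont|apply Hwc].
      * unfold field.
        apply (continuous_mult (fun y => sigma - f (u y) / slope y (exp (Lam y) * z y)) P);
          [|apply P_cont].
        apply (continuous_minus (fun _ => sigma)
          (fun y => f (u y) / slope y (exp (Lam y) * z y))); [apply continuous_const|].
        apply (continuous_mult (fun y => f (u y))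
          (fun y => / slope y (exp (Lam y) * z y))); [apply fu_cont|].
        apply continuous_Rinv_comp; [apply Hpc|].
        destruct (slope_bounds x _ (Hscale x _ (Hz x))). lra.
  (* Subsolution: the [rate] terms cancel on both sides and [field_at_lower] remains. *)
  - intros x. rewrite !Hexp, Ropp_mult_distr_r.
    apply Rmult_le_compat_l; [apply Rlt_le, exp_pos|].
    destruct (slope_bounds x (lower x)) as [Hp [_ Hb]].
    { pose proof (lower_le_V x). lra. }
    pose proof (field_at_lower x (slope x (lower x))) as Hf. unfold field. lra.
  (* Supersolution: on [V] the slope is [P x], so this is the barrier inequality [V_super]. *)
  - intros x. rewrite !Hexp, Ropp_mult_distr_r.
    apply Rmult_le_compat_l; [apply Rlt_le, exp_pos|].
    unfold field. rewrite slope_V. pose proof (V_super x). pose proof (P_pos x).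
    replace ((sigma - f (u x) / P x) * P x) with (sigma * P x - f (u x)) by (field; lra).
    lra.
  (* [Lam >= 0] on the positive half-line, so the scaling can only shrink [lower], which tends to
     0. *)
  - apply is_lim_spec. intros eps.
    destruct (lower_bound_small eps (cond_pos eps)) as [Y HY].
    exists (Rmax 0 Y). intros x Hx.
    pose proof (Rmax_l 0 Y). pose proof (Rmax_r 0 Y).
    specialize (HY x ltac:(lra)). pose proof (Lam_nonneg x ltac:(lra)) as HL.
    pose proof (lower_pos x). pose proof (exp_pos (- Lam x)).
    assert (exp (- Lam x) <= 1).
    { rewrite <- exp_0. destruct HL as [HL|HL].
      - apply Rlt_le, exp_increasing. lra.
      - rewrite <- HL, Ropp_0. lra. }
    simpl. rewrite Rminus_0_r, Rabs_pos_eq; nra.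
  - exists (fun x => exp (Lam x) * z x). split.
    + intros x. apply Hscale, Hz1.
    + intros x. specialize (Hz2 x). cbv beta in Hz2.
      set (w := exp (Lam x) * z x) in *.
      replace (field x w) with
        ((rate x * exp (Lam x)) * z x +
         exp (Lam x) * (- (exp (- Lam x) * (rate x * w - field x w)))).
      * apply (is_derive_mult (fun y => exp (Lam y)) z); [|easy|intros; apply Rmult_comm].
        apply (is_derive_comp exp Lam); [apply is_derive_exp|apply Lam_derive].
      * rewrite Ropp_mult_distr_r, Hexp. unfold w. ring.
Qed.

(** The profile is [u] run on a new clock: [X] inverts [tau], whose derivative is [P / p >= 1].
    Along [X], the slope of [U] is [p], its flux is [w], and the factor [p / P] turns the equation
    for [w] into the wave equation. The limits survive because [X] is increasing and inverts [tau]
    on the whole line. *)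
Lemma wave_of_barrier : exists U, classic_profile omega a f sigma U.
Proof.
  destruct flux_ode as [w [Hw1 Hw2]].
  set (p := fun x => slope x (w x)).
  assert (Hwc : forall x, continuous w x)
    by (intros x; apply (ex_derive_continuous w); eexists; apply Hw2).
  assert (Hpc : forall x, continuous p x) by (now apply slope_continuous).
  assert (Hp : forall x, 0 < p x <= P x) by (intros x; apply (slope_bounds x _ (Hw1 x))).
  assert (Hap : forall x, a (u x, p x) = w x) by (intros x; apply (slope_bounds x _ (Hw1 x))).
  set (d := fun x => P x / p x).
  assert (Hdc : forall x, continuous d x).
  { intros x. apply (continuous_mult P (fun y => / p y)); [apply P_cont|].
    apply continuous_Rinv_comp; [apply Hpc|]. specialize (Hp x). lra. }
  set (tau := fun x => RInt d 0 x).
  assert (Hdtau : forall x, is_derive tau x (d x)).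
  { intros x. apply (is_derive_RInt d tau 0 x); [|apply Hdc].
    apply filter_forall. intros y. apply (RInt_correct d 0 y), (ex_RInt_continuous d).
    intros; apply Hdc. }
  destruct (inverse_function_derive tau d) as [X [HX1 [HX2 HX3]]]; [easy| |].
  { intros x. specialize (Hp x). apply -> Rle_div_r; lra. }
  set (U := fun t => u (X t)). set (q := fun t => p (X t)).
  assert (HXc : forall t, continuous X t)
    by (intros t; apply (ex_derive_continuous X); eexists; apply HX3).
  assert (HdX : forall t, is_derive X t (p (X t) / P (X t))).
  { intros t. pose proof (P_pos (X t)). specialize (Hp (X t)).
    replace (p (X t) / P (X t)) with (/ d (X t)) by (unfold d; field; lra). apply HX3. }
  assert (HU : forall t, is_derive U t (q t)).
  { intros t. replace (q t) with (p (X t) / P (X t) * P (X t))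
      by (unfold q; pose proof (P_pos (X t)); field; lra).
    apply (is_derive_comp u X); [apply u_derive|apply HdX]. }
  assert (HW : forall t, is_derive (fun y => a (U y, q y)) t (sigma * q t - f (U t))).
  { intros t. apply (is_derive_ext (fun y => w (X y))); [intros y; symmetry; apply Hap|].
    replace (sigma * q t - f (U t)) with (p (X t) / P (X t) * field (X t) (w (X t))).
    - apply (is_derive_comp w X); [apply Hw2|apply HdX].
    - unfold field. fold (p (X t)). unfold q, U.
      pose proof (P_pos (X t)). specialize (Hp (X t)). field. lra. }
  assert (HqO : forall t, Omega omega (U t, q t)).
  { intros t. apply Omega_below. specialize (Hp (X t)). unfold q. lra. }
  assert (Hqc : forall t, continuous q t) by (intros t; apply (continuous_comp X p); easy).
  assert (HUc : forall t, continuous U t)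
    by (intros t; apply (ex_derive_continuous U); eexists; apply HU).
  (* The derivative of the flux is known, so [flux_implicit] yields the second derivative of [U], by
     a formula that is continuous in [t]. *)
  set (dq := fun t => (sigma * q t - f (U t) - a_u (U t, q t) * q t) / a_s (U t, q t)).
  assert (Hdq : forall t, is_derive q t (dq t)).
  { intros t. apply flux_implicit; try easy. apply u_range. }
  assert (HDU : forall t, Derive U t = q t) by (intros t; now apply is_derive_unique).
  assert (Hmono : forall s t, s < t -> X s < X t).
  { intros s t Hst. destruct (Rle_lt_dec (X t) (X s)) as [Hle|]; [exfalso|easy].
    assert (tau (X t) <= tau (X s)); [|rewrite !HX1 in *; lra].
    apply (derive_nonneg_nondecreasing tau d); [easy| |].
    - intros x _. apply Hdtau.
    - intros x _. apply Rdiv_le_0_compat; [apply Rlt_le, P_pos|apply Hp]. }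
  exists U. 
  split; [split; [|split]|split; [|split; [|split; [|split; [|split]]]]].
  - intros t. exists (q t). apply HU.
  - intros t. exists (dq t). apply (is_derive_ext q); [|easy].
    intros y. symmetry. apply HDU.
  - intros t.
    apply (continuous_ext dq).
    { intros y. symmetry. apply is_derive_unique.
      apply (is_derive_ext q); [|easy]. intros r. symmetry. apply HDU. }
    apply (continuous_mult (fun t => sigma * q t - f (U t) - a_u (U t, q t) * q t)
      (fun t => / a_s (U t, q t))).
    + apply (continuous_minus (fun t => sigma * q t - f (U t))
        (fun t => a_u (U t, q t) * q t)).
      * apply (continuous_minus (fun t => sigma * q t) (fun t => f (U t))).
        -- apply (continuous_mult (fun _ => sigma) q); [apply continuous_const|easy].
        -- apply (continuous_comp X (fun x => f (u x))); [easy|apply fu_cont].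
      * apply (continuous_mult (fun t => a_u (U t, q t)) q); [|easy].
        now apply Omega_cont_comp.
    + apply continuous_Rinv_comp; [now apply Omega_cont_comp|].
      pose proof (a_s_pos _ _ (HqO t)). lra.
  - intros s t Hst. apply (incr_function u m_infty p_infty P); simpl; try easy.
    + intros x _ _. apply P_pos.
    + now apply Hmono.
  - intros t. split; apply Rlt_le, u_range.
  - intros t. rewrite HDU. apply HqO.
  - apply is_lim_spec. intros eps. apply is_lim_spec in u_lim0.
    destruct (u_lim0 eps) as [B HB]. exists (tau B). intros t Ht.
    apply HB. rewrite <- (HX2 B). now apply Hmono.
  - apply is_lim_spec. intros eps. apply is_lim_spec in u_lim1.
    destruct (u_lim1 eps) as [B HB]. exists (tau B). intros t Ht.
    apply HB. rewrite <- (HX2 B). now apply Hmono.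
  - intros t.
    assert (HdW : is_derive (fun y => a (U y, Derive U y)) t (sigma * q t - f (U t))).
    { apply (is_derive_ext (fun y => a (U y, q y))); [|easy]. intros y. now rewrite HDU. }
    split.
    + eexists. apply HdW.
    + rewrite HDU. apply is_derive_unique in HdW.
      change (Derive (fun y => a (U y, Derive U y)) t = sigma * q t - f (U t)) in HdW.
      rewrite HdW. ring.
Qed.

End Barrier.

(** * Compactness bounds for the flux *)

(** A positive lower semicontinuous function on a compact interval is bounded away from 0; here this
    follows from the openness of [Omega] along the zero section. *)
Local Lemma Omega_box : exists s0, 0 < s0 /\
  forall u s, 0 <= u <= 1 -> Rabs s <= s0 -> Omega omega (u, s).
Proof.
  destruct (compact_uniform (fun u _ e => Omega omega (u, e)) 0 1 0 0) as [e [He1 He2]].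
  - intros u _ e e' He HO. apply (Omega_shrink u e); [easy|]. rewrite !Rabs_pos_eq; lra.
  - intros u y Hu _. destruct (Omega_open u 0 (Omega_zero u Hu)) as [d [Hd1 Hd2]].
    exists (d / 2). split; [lra|]. intros u' _ Hu' _ H1 _.
    apply Hd2; [easy|lra|]. rewrite Rminus_0_r, Rabs_pos_eq; lra.
  - exists e. split; [easy|]. intros u s Hu Hs. apply (Omega_shrink u e).
    + now apply (He2 u 0); [|lra].
    + now rewrite (Rabs_pos_eq e) by lra.
Qed.

Section CompactImage.

Context (b : R * R -> R) (U S : R * R -> R) (x0 x1 y0 y1 : R).
Context (b_cont : continuous_on (Omega omega) b)
  (U_cont : forall z, continuous U z) (S_cont : forall z, continuous S z)
  (US_Omega : forall x y, x0 <= x <= x1 -> y0 <= y <= y1 ->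
    Omega omega (U (x, y), S (x, y))).

Local Lemma compact_image_cont x y eps :
  x0 <= x <= x1 -> y0 <= y <= y1 -> 0 < eps -> exists delta, 0 < delta /\
  forall x' y', x0 <= x' <= x1 -> y0 <= y' <= y1 ->
    Rabs (x' - x) < delta -> Rabs (y' - y) < delta ->
    Rabs (b (U (x', y'), S (x', y')) - b (U (x, y), S (x, y))) < eps.
Proof.
  intros Hx Hy Heps.
  destruct (Omega_cont b _ _ b_cont (US_Omega x y Hx Hy) eps Heps) as [d [Hd1 Hd2]].
  destruct (proj1 (filterlim_locally _ _) (U_cont (x, y)) (mkposreal d Hd1)) as [dU HdU].
  destruct (proj1 (filterlim_locally _ _) (S_cont (x, y)) (mkposreal d Hd1)) as [dS HdS].
  exists (Rmin dU dS). split; [apply Rmin_pos; apply cond_pos|].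
  intros x' y' Hx' Hy' H1 H2. apply Hd2; [now apply US_Omega| |].
  - apply (HdU (x', y')). pose proof (Rmin_l dU dS).
    split; [apply (Rlt_le_trans _ _ _ H1)|apply (Rlt_le_trans _ _ _ H2)]; easy.
  - apply (HdS (x', y')). pose proof (Rmin_r dU dS).
    split; [apply (Rlt_le_trans _ _ _ H1)|apply (Rlt_le_trans _ _ _ H2)]; easy.
Qed.

(** The compact set is parametrized by a rectangle, so that it can be the box itself, through [fst]
    and [snd], or the region under the slope of a wave, through [(u x, t * P x)] with [t] in the
    unit interval. *)
Local Lemma compact_image_bounded : exists B, 0 < B /\
  forall x y, x0 <= x <= x1 -> y0 <= y <= y1 -> Rabs (b (U (x, y), S (x, y))) <= B.
Proof.
  destruct (compact_uniform (fun x y e => Rabs (b (U (x, y), S (x, y))) <= / e) x0 x1 y0 y1)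
    as [e [He1 He2]].
  - intros x y e e' He H. apply Rle_trans with (1 := H). apply Rinv_le_contravar; lra.
  - intros x y Hx Hy. destruct (compact_image_cont x y 1 Hx Hy Rlt_0_1) as [d [Hd1 Hd2]].
    set (B := Rabs (b (U (x, y), S (x, y))) + 1).
    assert (HB : 0 < B) by (pose proof (Rabs_pos (b (U (x, y), S (x, y)))); unfold B; lra).
    assert (Hmin : 0 < Rmin d (/ B)) by (apply Rmin_pos; [easy|now apply Rinv_0_lt_compat]).
    exists (Rmin d (/ B)). split; [easy|]. intros x' y' Hx' Hy' H1 H2.
    pose proof (Rmin_l d (/ B)). specialize (Hd2 x' y' Hx' Hy' ltac:(lra) ltac:(lra)).
    apply Rle_trans with B.
    + pose proof (Rabs_triang_inv (b (U (x', y'), S (x', y'))) (b (U (x, y), S (x, y)))).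
      unfold B. lra.
    + apply Rle_trans with (/ / B); [rewrite Rinv_inv; apply Rle_refl|].
      apply Rinv_le_contravar; [easy|apply Rmin_r].
  - exists (/ e). split; [now apply Rinv_0_lt_compat|easy].
Qed.

Local Lemma compact_image_positive :
  (forall u s, Omega omega (u, s) -> 0 < b (u, s)) -> exists e, 0 < e /\
  forall x y, x0 <= x <= x1 -> y0 <= y <= y1 -> e <= b (U (x, y), S (x, y)).
Proof.
  intros Hpos. apply (compact_uniform (fun x y e => e <= b (U (x, y), S (x, y)))).
  - intros x y e e' He H. lra.
  - intros x y Hx Hy. pose proof (Hpos _ _ (US_Omega x y Hx Hy)) as Hb.
    destruct (compact_image_cont x y (b (U (x, y), S (x, y)) / 2) Hx Hy) as [d [Hd1 Hd2]];
      [lra|].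
    exists (Rmin d (b (U (x, y), S (x, y)) / 2)). split; [apply Rmin_pos; lra|].
    intros x' y' Hx' Hy' H1 H2.
    pose proof (Rmin_l d (b (U (x, y), S (x, y)) / 2)).
    pose proof (Rmin_r d (b (U (x, y), S (x, y)) / 2)).
    specialize (Hd2 x' y' Hx' Hy' ltac:(lra) ltac:(lra)). apply Rabs_def2 in Hd2. lra.
Qed.

End CompactImage.

Local Lemma flux_box : exists s0 m M, 0 < s0 /\ 0 < m /\ 0 < M /\
  (forall u s, 0 <= u <= 1 -> 0 <= s <= s0 -> Omega omega (u, s)) /\
  (forall u s, 0 <= u <= 1 -> 0 <= s <= s0 ->
    m <= a_s (u, s) <= M /\ Rabs (a_u (u, s)) <= M).
Proof.
  destruct Omega_box as [s0 [Hs0 HO]].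
  assert (HO' : forall u s, 0 <= u <= 1 -> 0 <= s <= s0 -> Omega omega (u, s)).
  { intros u s Hu Hs. apply HO; [easy|]. rewrite Rabs_pos_eq; lra. }
  destruct (compact_image_positive a_s fst snd 0 1 0 s0 a_s_cont) as [m [Hm1 Hm2]];
    try easy; [intros; apply continuous_fst|intros; apply continuous_snd|].
  destruct (compact_image_bounded a_s fst snd 0 1 0 s0 a_s_cont) as [M1 [HM11 HM12]];
    try easy; [intros; apply continuous_fst|intros; apply continuous_snd|].
  destruct (compact_image_bounded a_u fst snd 0 1 0 s0 a_u_cont) as [M2 [HM21 HM22]];
    try easy; [intros; apply continuous_fst|intros; apply continuous_snd|].
  exists s0, m, (M1 + M2).
  split; [easy|]. split; [easy|]. split; [lra|]. split; [easy|]. intros u s Hu Hs.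
  specialize (Hm2 u s Hu Hs). specialize (HM12 u s Hu Hs). specialize (HM22 u s Hu Hs).
  simpl in *. pose proof (Rle_abs (a_s (u, s))). lra.
Qed.

(** * Barriers and the lower bound on the speed *)

Section Reaction.

Context (f df : R -> R) (L : R).
Context
  (f_derive : forall r, 0 < r < 1 -> is_derive f r (df r))
  (df_bound : forall r, 0 < r < 1 -> Rabs (df r) <= L)
  (f_pos : forall r, 0 < r < 1 -> 0 < f r)
  (f_bound : forall r, 0 < r < 1 -> f r <= L * (r * (1 - r))).

(* A slow logistic profile is a barrier at every large speed. *)
Local Lemma some_speed : exists sigma U, classic_profile omega a f sigma U.
Proof.
  destruct flux_box as [s0 [m [M [Hs0 [Hm [HM [HO Hb]]]]]]].
  assert (HL : 0 <= L).
  { pose proof (Rabs_pos (df (1 / 2))). pose proof (df_bound (1 / 2)). lra. }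
  (* The rate [s0] ensures [P <= s0], so the profile stays in the box together with all smaller
     slopes. *)
  set (u := fun x => / (1 + exp (- (s0 * x)))).
  set (P := fun x => s0 * (u x * (1 - u x))).
  assert (Hu : forall x, 0 < u x < 1).
  { intros x. pose proof (exp_pos (- (s0 * x))). unfold u. split.
    - apply Rinv_0_lt_compat. lra.
    - rewrite <- Rinv_1. apply Rinv_lt_contravar; lra. }
  assert (Hdu : forall x, is_derive u x (P x)).
  { intros x. pose proof (exp_pos (- (s0 * x))). unfold P, u.
    auto_derive; [lra|]. field. lra. }
  assert (HdP : forall x, is_derive P x (s0 * (1 - 2 * u x) * P x)).
  { intros x. apply is_derive_ext with (fun x => s0 * (u x - u x * u x)).
    { intros t. change (s0 * (u t - u t * u t) = s0 * (u t * (1 - u t))). ring. }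
    replace (s0 * (1 - 2 * u x) * P x) with (s0 * (P x - (P x * u x + u x * P x))) by ring.
    apply is_derive_scal. apply (is_derive_minus u (fun x => u x * u x)); [easy|].
    apply (is_derive_mult u u); [easy|easy|intros; apply Rmult_comm]. }
  assert (HP : forall x, 0 < P x).
  { intros x. specialize (Hu x). unfold P. repeat apply Rmult_lt_0_compat; lra. }
  assert (HPs : forall x, P x <= s0).
  { intros x. specialize (Hu x). unfold P. nra. }
  (* In units of [P x]: [M] bounds the [a_u] term of the derivative of the flux, [s0 * M] its [a_s]
     term, and [L / s0] the reaction. *)
  set (sigma := M + s0 * M + L / s0).
  exists sigma.
  apply (wave_of_barrier f df L sigma u P
    (fun x => a_u (u x, P x) * P x + a_s (u x, P x) * (s0 * (1 - 2 * u x) * P x)) m M);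
    try easy.
  - intros x. apply (ex_derive_continuous P). eexists. apply HdP.
  - apply is_lim_spec. intros eps. exists (ln eps / s0). intros x Hx.
    apply Rlt_div_r in Hx; [|lra].
    specialize (Hu x). rewrite Rminus_0_r, Rabs_pos_eq by lra.
    apply Rlt_trans with (exp (s0 * x)).
    + unfold u. rewrite exp_Ropp.
      pose proof (exp_pos (s0 * x)). pose proof (Rinv_0_lt_compat _ H).
      rewrite <- (Rinv_inv (exp (s0 * x))) at 2.
      apply Rinv_lt_contravar; [apply Rmult_lt_0_compat|]; lra.
    + rewrite <- (exp_ln eps) by apply cond_pos. apply exp_increasing. lra.
  - apply is_lim_spec. intros eps. exists (- ln eps / s0). intros x Hx.
    apply Rlt_div_l in Hx; [|lra].
    specialize (Hu x). rewrite Rabs_minus_sym, Rabs_pos_eq by lra.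
    apply Rlt_trans with (exp (- (s0 * x))).
    + unfold u. pose proof (exp_pos (- (s0 * x))).
      replace (1 - / (1 + exp (- (s0 * x))))
        with (exp (- (s0 * x)) / (1 + exp (- (s0 * x)))) by (field; lra).
      apply Rlt_div_l; [lra|]. nra.
    + rewrite <- (exp_ln eps) by apply cond_pos. apply exp_increasing. lra.
  - intros x. apply HO; [specialize (Hu x); lra|]. specialize (HP x); specialize (HPs x). lra.
  - intros x. apply flux_chain_rule; try easy.
    apply HO; [specialize (Hu x); lra|]. specialize (HP x); specialize (HPs x). lra.
  - intros x. specialize (Hu x). specialize (HP x). specialize (HPs x).
    destruct (Hb (u x) (P x)) as [H1 H2]; [lra|lra|]. apply Rabs_le_between in H2.
    pose proof (f_bound _ Hu) as Hf.
    assert (Hf' : f (u x) <= L / s0 * P x).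
    { unfold P. replace (L / s0 * (s0 * (u x * (1 - u x)))) with (L * (u x * (1 - u x)))
        by (field; lra). easy. }
    assert (Has : a_s (u x, P x) * (s0 * (1 - 2 * u x) * P x) <= s0 * M * P x).
    { replace (a_s (u x, P x) * (s0 * (1 - 2 * u x) * P x))
        with (a_s (u x, P x) * (1 - 2 * u x) * (s0 * P x)) by ring.
      replace (s0 * M * P x) with (M * (s0 * P x)) by ring.
      apply Rmult_le_compat_r; [nra|]. nra. }
    assert (Hau : a_u (u x, P x) * P x <= M * P x) by (apply Rmult_le_compat_r; lra).
    unfold sigma. lra.
  - intros x p Hp. apply Hb; [specialize (Hu x); lra|]. specialize (HPs x). lra.
Qed.

(** * A priori estimates for a wave *)

Section Wave.

Context (sigma : R) (u : R -> R) (Hwave : classic_profile omega a f sigma u).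

Let P := Derive u.
Let v (x : R) := a (u x, P x).
(** Along a wave [G' = - f(u) < 0]. This monotone quantity carries information on the flux to and
    from infinity, where a profile is only required to converge. *)
Let G (x : R) := v x - sigma * u x.

Local Lemma wave_range x : 0 < u x < 1.
Proof.
  destruct Hwave as [_ [Hmono [Hr _]]].
  pose proof (Hmono (x - 1) x ltac:(lra)). pose proof (Hmono x (x + 1) ltac:(lra)).
  pose proof (Hr (x - 1)). pose proof (Hr (x + 1)). lra.
Qed.

Local Lemma wave_derive x : is_derive u x (P x).
Proof. apply Derive_correct, Hwave. Qed.

Local Lemma wave_slope_cont x : continuous P x.
Proof. apply (ex_derive_continuous P). apply Hwave. Qed.

Local Lemma wave_Omega x : Omega omega (u x, P x).
Proof. apply Hwave. Qed.

Local Lemma wave_flux_derive x : is_derive v x (sigma * P x - f (u x)).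
Proof.
  destruct Hwave as [_ [_ [_ [_ [_ [_ Heq]]]]]]. destruct (Heq x) as [H1 H2].
  replace (sigma * P x - f (u x)) with (Derive v x).
  - now apply Derive_correct.
  - unfold v, P in *. lra.
Qed.

Local Lemma flux_le x p q : Omega omega (u x, p) -> Omega omega (u x, q) -> p <= q ->
  a (u x, p) <= a (u x, q).
Proof.
  intros Hp Hq [Hlt|Heq]; [|rewrite Heq; apply Rle_refl].
  apply Rlt_le. now apply Ha.
Qed.

Local Lemma wave_slope_nonneg x : 0 <= P x.
Proof.
  destruct (Rle_lt_dec 0 (P x)) as [|Hlt]; [easy|exfalso].
  destruct (derive_neg_decreases u x (P x) 1 (wave_derive x) Hlt Rlt_0_1) as [h [Hh1 Hh2]].
  destruct Hwave as [_ [Hmono _]]. specialize (Hmono x (x + h) ltac:(lra)). lra.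
Qed.

Local Lemma wave_flux_nonneg x : 0 <= v x.
Proof.
  pose proof (wave_range x). rewrite <- (flux_zero (u x)) by lra.
  apply flux_le; [apply Omega_zero; lra|apply wave_Omega|apply wave_slope_nonneg].
Qed.

(** Where the slope vanishes, so does the flux, with derivative [- f (u x) < 0]; the flux would then
    be negative just to the right. *)
Local Lemma wave_slope_pos x : 0 < P x.
Proof.
  destruct (wave_slope_nonneg x) as [|Heq]; [easy|exfalso].
  pose proof (wave_flux_derive x) as Hd. rewrite <- Heq, Rmult_0_r, Rminus_0_l in Hd.
  pose proof (wave_range x) as Hu. pose proof (f_pos _ Hu).
  destruct (derive_neg_decreases v x _ 1 Hd ltac:(lra) Rlt_0_1) as [h [Hh1 Hh2]].
  pose proof (wave_flux_nonneg (x + h)).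
  assert (v x = 0) by (unfold v; rewrite <- Heq; apply flux_zero; lra). lra.
Qed.

Local Lemma wave_mono x y : x <= y -> u x <= u y.
Proof.
  intros [Hlt| ->]; [|apply Rle_refl]. destruct Hwave as [_ [Hmono _]].
  now apply Rlt_le, Hmono.
Qed.

Local Lemma G_decr x y : x <= y -> G y <= G x.
Proof.
  intros Hxy. enough (- G x <= - G y) by lra.
  apply (derive_nonneg_nondecreasing (fun t => - G t) (fun t => f (u t))); [easy| |].
  - intros t _. replace (f (u t)) with (- (sigma * P t - f (u t) - sigma * P t)) by ring.
    apply (is_derive_opp G). apply (is_derive_minus v (fun t => sigma * u t)).
    + apply wave_flux_derive.
    + apply is_derive_scal, wave_derive.
  - intros t _. apply Rlt_le, f_pos, wave_range.
Qed.

Section Box.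

Context (s0 m0 M0 : R) (s0_pos : 0 < s0) (m0_pos : 0 < m0) (M0_pos : 0 < M0)
  (box_Omega : forall r s, 0 <= r <= 1 -> 0 <= s <= s0 -> Omega omega (r, s))
  (box_a_s : forall r s, 0 <= r <= 1 -> 0 <= s <= s0 ->
    m0 <= a_s (r, s) <= M0 /\ Rabs (a_u (r, s)) <= M0).

Local Lemma box_flux x s : 0 <= s <= s0 -> m0 * s <= a (u x, s) <= M0 * s.
Proof.
  intros Hs. pose proof (wave_range x) as Hu.
  pose proof (flux_increment m0 M0 (u x) 0 s) as H.
  rewrite flux_zero, !Rminus_0_r in H by lra. apply H.
  - apply box_Omega; lra.
  - lra.
  - intros p Hp. apply box_a_s; lra.
Qed.

Local Lemma wave_flux_small x s : 0 <= s <= s0 -> v x <= m0 * s -> P x <= s.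
Proof.
  intros Hs Hv. destruct (Rle_lt_dec (P x) s) as [|Hlt]; [easy|exfalso].
  pose proof (wave_range x). pose proof (box_flux x s Hs).
  assert (a (u x, s) < v x); [|lra].
  apply Ha; [apply box_Omega; lra|apply wave_Omega|easy].
Qed.

(** A flux above [delta] forces a slope of at least [s1], and [u] gains less than 1 in total, so
    this cannot last over a length [/ s1]. *)
Local Lemma wave_flux_often_small delta : 0 < delta ->
  exists r, 0 < r /\ forall x, exists y, x <= y <= x + r /\ v y <= delta.
Proof.
  intros Hd. set (s1 := Rmin s0 (delta / M0)).
  assert (Hs1 : 0 < s1) by (apply Rmin_pos; [easy|now apply Rdiv_lt_0_compat]).
  assert (Hs10 : s1 <= s0) by apply Rmin_l.
  assert (Hs1d : M0 * s1 <= delta).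
  { rewrite Rmult_comm. apply <- Rle_div_r; [apply Rmin_r|lra]. }
  exists (/ s1). split; [now apply Rinv_0_lt_compat|]. intros x.
  apply NNPP. intros Hn.
  assert (Hbig : forall y, x <= y <= x + / s1 -> s1 <= P y).
  { intros y Hy. destruct (Rle_lt_dec s1 (P y)) as [|Hlt]; [easy|exfalso].
    apply Hn. exists y. split; [easy|].
    pose proof (wave_slope_nonneg y).
    pose proof (box_flux y (P y) ltac:(lra)) as Hbx. fold (v y) in Hbx. nra. }
  assert (Hinv : s1 * / s1 = 1) by (apply Rinv_r; lra).
  pose proof (Rinv_0_lt_compat _ Hs1).
  assert (u x - s1 * x <= u (x + / s1) - s1 * (x + / s1)).
  { apply (derive_nonneg_nondecreasing (fun t => u t - s1 * t) (fun t => P t - s1));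
      [lra| |].
    - intros t _. apply (is_derive_minus u (fun t => s1 * t)); [apply wave_derive|].
      auto_derive; [easy|ring].
    - intros t Ht. specialize (Hbig t Ht). lra. }
  pose proof (wave_range x). pose proof (wave_range (x + / s1)). lra.
Qed.

(** [G] is nonincreasing, and far to the left there are points where both [v] and [u] are small,
    hence [G] is nearly 0; so [G] cannot be positive anywhere. *)
Local Lemma wave_flux_le x : v x <= sigma * u x.
Proof.
  enough (G x <= 0) by (unfold G in *; lra).
  destruct (Rle_lt_dec (G x) 0) as [|Hc]; [easy|exfalso].
  destruct Hwave as [_ [_ [_ [_ [Hlim _]]]]].
  apply is_lim_spec in Hlim. pose proof (Rabs_pos sigma) as Hsig.
  assert (He : 0 < G x / (2 * (Rabs sigma + 1))) by (apply Rdiv_lt_0_compat; lra).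
  destruct (Hlim (mkposreal _ He)) as [Y HY].
  destruct (wave_flux_often_small (G x / 4)) as [r [Hr Hsm]]; [lra|].
  (* The window [[z, z + r]] lies to the left of both [Y] and [x]. In it [v] costs [G x / 4] and
     [sigma * u] less than [G x / 2], in total less than [G x]. *)
  set (z := Rmin (Y - 1) x - r).
  destruct (Hsm z) as [y [Hy1 Hy2]].
  assert (HyY : y < Y) by (pose proof (Rmin_l (Y - 1) x); unfold z in *; lra).
  assert (Hyx : y <= x) by (pose proof (Rmin_r (Y - 1) x); unfold z in *; lra).
  specialize (HY y HyY). simpl in HY. rewrite Rminus_0_r in HY.
  pose proof (wave_range y) as Hu. rewrite Rabs_pos_eq in HY by lra.
  apply <- Rlt_div_r in HY; [|lra].
  pose proof (G_decr y x Hyx) as HG. unfold G at 2 in HG.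
  pose proof (Rle_abs (- sigma)) as Habs. rewrite Rabs_Ropp in Habs.
  assert (- (sigma * u y) <= Rabs sigma * u y) by nra. lra.
Qed.

Local Lemma wave_speed_pos : 0 < sigma.
Proof.
  pose proof (wave_range 0). pose proof (wave_flux_le 0).
  assert (Hv : a (u 0, 0) < v 0).
  { apply Ha; [apply Omega_zero; lra|apply wave_Omega|apply wave_slope_pos]. }
  rewrite flux_zero in Hv by lra. nra.
Qed.

(** On the left [v <= sigma * u] suffices. On the right, monotonicity of [G] from a point [y] with
    small flux gives [v x <= v y + sigma * (u x - u y)], and [u y] is close to 1. *)
Local Lemma wave_flux_vanishes delta : 0 < delta ->
  exists X, forall x, X <= Rabs x -> v x <= delta.
Proof.
  intros Hd. pose proof wave_speed_pos as Hs.
  assert (He : 0 < delta / (2 * sigma)) by (apply Rdiv_lt_0_compat; lra).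
  destruct Hwave as [_ [_ [_ [_ [Hlim0 [Hlim1 _]]]]]].
  apply is_lim_spec in Hlim0. apply is_lim_spec in Hlim1.
  destruct (Hlim0 (mkposreal _ He)) as [X0 H0].
  destruct (Hlim1 (mkposreal _ He)) as [X1 H1].
  destruct (wave_flux_often_small (delta / 2)) as [r [Hr Hsm]]; [lra|].
  destruct (Hsm (X1 + 1)) as [y [Hy1 Hy2]].
  exists (Rmax y (- X0 + 1)). intros x Hx.
  pose proof (Rmax_l y (- X0 + 1)). pose proof (Rmax_r y (- X0 + 1)).
  unfold Rabs in Hx. destruct (Rcase_abs x).
  - specialize (H0 x ltac:(lra)). simpl in H0. rewrite Rminus_0_r in H0.
    pose proof (wave_range x). rewrite Rabs_pos_eq in H0 by lra.
    apply <- Rlt_div_r in H0; [|lra]. pose proof (wave_flux_le x). lra.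
  - specialize (H1 y ltac:(lra)). simpl in H1. apply Rabs_def2 in H1.
    pose proof (wave_range x). pose proof (wave_range y).
    assert (Hy : 1 - u y < delta / (2 * sigma)) by lra.
    apply <- Rlt_div_r in Hy; [|lra].
    pose proof (G_decr y x ltac:(lra)) as HG. unfold G in HG.
    assert (sigma * u x <= sigma) by nra. lra.
Qed.

(** Far out the flux is small, so the slope is at most [s0] and the box bounds apply. The remaining
    points form the image of a compact rectangle, with [p] written as [t * P x]. *)
Local Lemma wave_a_s_bounds : exists m M, 0 < m /\
  forall x p, 0 <= p <= P x -> m <= a_s (u x, p) <= M.
Proof.
  destruct (wave_flux_vanishes (m0 * s0)) as [X HX]; [now apply Rmult_lt_0_compat|].
  assert (Hcu : forall z : R * R, continuous (fun z => u (fst z)) z).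
  { intros z. apply continuous_comp; [apply continuous_fst|].
    apply (ex_derive_continuous u). eexists. apply wave_derive. }
  assert (HcS : forall z : R * R, continuous (fun z => snd z * P (fst z)) z).
  { intros z. apply (continuous_mult snd (fun z => P (fst z))); [apply continuous_snd|].
    apply continuous_comp; [apply continuous_fst|apply wave_slope_cont]. }
  assert (HO : forall x t, - X <= x <= X -> 0 <= t <= 1 ->
    Omega omega (u (fst (x, t)), snd (x, t) * P (fst (x, t)))).
  { intros x t _ Ht. simpl. apply (Omega_shrink _ (P x)); [apply wave_Omega|].
    pose proof (wave_slope_pos x). rewrite !Rabs_pos_eq; nra. }
  destruct (compact_image_positive a_s (fun z => u (fst z)) (fun z => snd z * P (fst z))
    (- X) X 0 1 a_s_cont Hcu HcS HO a_s_pos) as [m1 [Hm1 Hm2]].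
  destruct (compact_image_bounded a_s (fun z => u (fst z)) (fun z => snd z * P (fst z))
    (- X) X 0 1 a_s_cont Hcu HcS HO) as [M1 [HM1 HM2]].
  exists (Rmin m0 m1), (Rmax M0 M1). split; [now apply Rmin_pos|].
  intros x p Hp.
  pose proof (Rmin_l m0 m1). pose proof (Rmin_r m0 m1).
  pose proof (Rmax_l M0 M1). pose proof (Rmax_r M0 M1).
  destruct (Rle_lt_dec X (Rabs x)) as [Hx|Hx].
  - pose proof (wave_flux_small x s0 ltac:(lra) (HX x Hx)).
    pose proof (wave_range x).
    destruct (box_a_s (u x) p) as [Hb _]; lra.
  - apply Rabs_def2 in Hx. pose proof (wave_slope_pos x) as HP.
    assert (Ht : 0 <= p / P x <= 1).
    { split; [apply Rdiv_le_0_compat; lra|]. apply <- Rle_div_l; lra. }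
    specialize (Hm2 x (p / P x) ltac:(lra) Ht). specialize (HM2 x (p / P x) ltac:(lra) Ht).
    simpl in Hm2, HM2. replace (p / P x * P x) with p in * by (field; lra).
    pose proof (Rle_abs (a_s (u x, p))). lra.
Qed.

Local Lemma faster_wave sigma' : sigma <= sigma' ->
  exists U, classic_profile omega a f sigma' U.
Proof.
  intros Hs. destruct wave_a_s_bounds as [m [M [Hm Hb]]].
  apply (wave_of_barrier f df L sigma' u P (fun x => sigma * P x - f (u x)) m M); try easy.
  - apply wave_derive.
  - apply wave_slope_pos.
  - apply wave_slope_cont.
  - apply wave_range.
  - apply Hwave.
  - apply Hwave.
  - apply wave_Omega.
  - apply wave_flux_derive.
  - intros x. pose proof (wave_slope_pos x). nra.
Qed.

(* For slow waves [u' <= sigma / m0], so [u] spends a time at least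
   [m0 / (2 sigma)] in [1/4, 3/4], where the source costs flux at rate [fm]. *)
Local Lemma wave_speed_lower_bound fm : 0 < fm ->
  (forall r, 1 / 4 <= r <= 3 / 4 -> fm <= f r) ->
  Rmin (1 / 2) (Rmin (m0 * s0) (fm * m0 / 2)) <= sigma.
Proof.
  intros Hfm Hf. apply Rnot_lt_le. intros Hlt.
  pose proof (Rmin_l (1 / 2) (Rmin (m0 * s0) (fm * m0 / 2))).
  pose proof (Rmin_r (1 / 2) (Rmin (m0 * s0) (fm * m0 / 2))).
  pose proof (Rmin_l (m0 * s0) (fm * m0 / 2)).
  pose proof (Rmin_r (m0 * s0) (fm * m0 / 2)).
  pose proof wave_speed_pos as Hs.
  (* [v <= sigma] by [wave_flux_le], and [sigma < m0 * s0] keeps [sigma / m0] inside the box. *)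
  assert (Hslow : forall x, P x <= sigma / m0).
  { intros x. apply wave_flux_small.
    - split; [apply Rdiv_le_0_compat; lra|]. apply <- Rle_div_l; lra.
    - replace (m0 * (sigma / m0)) with sigma by (field; lra).
      pose proof (wave_flux_le x). pose proof (wave_range x). nra. }
  assert (Hval : forall y, 0 < y < 1 -> exists x, u x = y).
  { intros y Hy. destruct (IVT_Rbar_incr u m_infty p_infty 0 1 y) as [x Hx]; try easy.
    - apply Hwave.
    - apply Hwave.
    - intros x _ _. apply continuity_pt_filterlim. apply (ex_derive_continuous u).
      eexists. apply wave_derive.
    - now exists x. }
  destruct (Hval (1 / 4)) as [x1 Hx1]; [lra|]. destruct (Hval (3 / 4)) as [x2 Hx2]; [lra|].
  assert (Hx12 : x1 <= x2).
  { apply Rnot_lt_le. intros Hx. pose proof (wave_mono x2 x1 ltac:(lra)). lra. }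
  assert (Htime : sigma / m0 * x1 - u x1 <= sigma / m0 * x2 - u x2).
  { apply (derive_nonneg_nondecreasing (fun t => sigma / m0 * t - u t)
      (fun t => sigma / m0 - P t)); [easy| |].
    - intros t _. apply (is_derive_minus (fun t => sigma / m0 * t) u); [|apply wave_derive].
      auto_derive; [easy|ring].
    - intros t _. specialize (Hslow t). lra. }
  assert (Hcost : - G x1 - fm * x1 <= - G x2 - fm * x2).
  { apply (derive_nonneg_nondecreasing (fun t => - G t - fm * t)
      (fun t => f (u t) - fm)); [easy| |].
    - intros t _. apply (is_derive_minus (fun t => - G t) (fun t => fm * t)).
      + replace (f (u t)) with (- (sigma * P t - f (u t) - sigma * P t)) by ring.
        apply (is_derive_opp G). apply (is_derive_minus v (fun t => sigma * u t)).
        * apply wave_flux_derive.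
        * apply is_derive_scal, wave_derive.
      + auto_derive; [easy|ring].
    - intros t Ht. enough (fm <= f (u t)) by lra. apply Hf.
      pose proof (wave_mono x1 t (proj1 Ht)). pose proof (wave_mono t x2 (proj2 Ht)). lra. }
  assert (HG1 : G x1 <= 0) by (pose proof (wave_flux_le x1); unfold G; lra).
  assert (HG2 : - (3 / 4 * sigma) <= G x2)
    by (pose proof (wave_flux_nonneg x2); unfold G; rewrite Hx2; lra).
  (* From [x1] to [x2] the profile gains 1/2 with slope at most [sigma / m0]. *)
  assert (H5 : m0 <= 2 * sigma * (x2 - x1)).
  { replace (2 * sigma * (x2 - x1)) with (2 * m0 * (sigma / m0 * (x2 - x1))) by (field; lra).
    nra. }
  assert (H6 : fm * (x2 - x1) <= 3 / 4 * sigma) by lra.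
  assert (H7 : fm * m0 <= 2 * sigma * (3 / 4 * sigma)).
  { apply Rle_trans with (fm * (2 * sigma * (x2 - x1))); [now apply Rmult_le_compat_l; [lra|]|].
    replace (fm * (2 * sigma * (x2 - x1))) with (2 * sigma * (fm * (x2 - x1))) by ring.
    apply Rmult_le_compat_l; lra. }
  (* The negated bound gives [2 * sigma < fm * m0], while [H7] and [sigma < 1 / 2] give
     [fm * m0 <= 3 / 4 * sigma]; the 1/2 in the minimum serves to absorb the square of [sigma]. *)
  nra.
Qed.

End Box.

End Wave.

End Reaction.

End Flux.

(** * Reduction to profiles, and the critical speed *)

Lemma travelling_wave_iff_profile (omega : R -> Rbar) (a : R * R -> R) (f : R -> R)
  (sigma : R) :
  (exists U, classic_travelling_wave omega a f sigma U) <->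
  (exists u, classic_profile omega a f sigma u).
Proof.
  split.
  - intros [U [_ [u [Hu _]]]]. now exists u.
  - intros [u Hu]. exists (fun t x => u (x + sigma * t)). split; [|now exists u].
    destruct Hu as [[Hdu _] [_ [_ [HO [_ [_ Heq]]]]]].
    intros t x.
    assert (HD : forall y, is_derive (fun y => u (y + sigma * t)) y (Derive u (y + sigma * t))).
    { intros y. rewrite <- (Rmult_1_l (Derive u (y + sigma * t))).
      apply (is_derive_comp u (fun y => y + sigma * t)).
      - apply Derive_correct, Hdu.
      - auto_derive; [easy|ring]. }
    assert (HDx : forall y, Derive (fun y => u (y + sigma * t)) y = Derive u (y + sigma * t))
      by (intros y; apply is_derive_unique, HD).
    assert (HDt : is_derive (fun tau => u (x + sigma * tau)) t
      (sigma * Derive u (x + sigma * t))).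
    { apply (is_derive_comp u (fun tau => x + sigma * tau)).
      - apply Derive_correct, Hdu.
      - auto_derive; [easy|ring]. }
    destruct (Heq (x + sigma * t)) as [Hex He].
    assert (HDa : is_derive (fun y => a (u (y + sigma * t), Derive (fun y => u (y + sigma * t)) y))
      x (Derive (fun y => a (u y, Derive u y)) (x + sigma * t))).
    { apply (is_derive_ext (fun y => a (u (y + sigma * t), Derive u (y + sigma * t)))).
      - intros y. now rewrite HDx.
      - rewrite <- (Rmult_1_l (Derive (fun y => a (u y, Derive u y)) _)).
        apply (is_derive_comp (fun y => a (u y, Derive u y)) (fun y => y + sigma * t)).
        + now apply Derive_correct.
        + auto_derive; [easy|ring]. }
    split; [rewrite HDx; apply HO|].
    split; [eexists; apply HDt|].
    split; [eexists; apply HD|].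
    split; [eexists; apply HDa|].
    assert (Et : Derive (fun tau : R => u (x + sigma * tau)) t
      = sigma * Derive u (x + sigma * t)) by (apply is_derive_unique, HDt).
    apply is_derive_unique in HDa. simpl in *. rewrite Et. lra.
Qed.

Theorem theorem2p1 (omega : R -> Rbar) (a : R * R -> R) (f : R -> R)
  (Homega : admissible_domain omega)
  (Ha : admissible_flux omega a)
  (Hf : admissible_reaction f)
  (HaC1 : C1_Omega omega a)
  (Has : forall u s : R, Omega omega (u, s) ->
           0 < Derive (fun r => a (u, r)) s) :
  exists sigma_r : R, 0 < sigma_r /\
    (forall sigma : R, sigma_r < sigma ->
       exists U : R -> R -> R, classic_travelling_wave omega a f sigma U) /\
    (forall sigma : R, sigma < sigma_r ->
       ~ exists U : R -> R -> R, classic_travelling_wave omega a f sigma U).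
Proof.
  destruct HaC1 as [a_u [a_s [Hder [Hau Has_c]]]].
  assert (Hpos : forall u s, Omega omega (u, s) -> 0 < a_s (u, s)).
  { intros u s HO. rewrite <- (is_derive_unique _ _ _ (proj2 (Hder u s HO))). now apply Has. }
  destruct (reaction_bounds f Hf) as [df [L [Hdf [HL Hfb]]]].
  pose proof (proj2 (proj2 (proj2 Hf))) as Hfpos.
  destruct (flux_box omega a_u a_s) as [s0 [m0 [M0 [Hs0 [Hm0 [HM0 [Hbox Hbs]]]]]]]; try easy.
  assert (Hfm : exists fm, 0 < fm /\ forall r, 1 / 4 <= r <= 3 / 4 -> fm <= f r).
  { destruct (continuity_ab_min f (1 / 4) (3 / 4)) as [z [Hz1 Hz2]]; [lra| |].
    - intros c Hc. apply continuity_pt_filterlim. apply (ex_derive_continuous f).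
      eexists. apply Hdf. lra.
    - exists (f z). split; [apply Hfpos; lra|easy]. }
  destruct Hfm as [fm [Hfm1 Hfm2]].
  set (c := Rmin (1 / 2) (Rmin (m0 * s0) (fm * m0 / 2))).
  assert (Hc : 0 < c).
  { repeat apply Rmin_pos; try lra; [now apply Rmult_lt_0_compat|].
    assert (0 < fm * m0) by (now apply Rmult_lt_0_compat). lra. }
  set (speed := fun sigma => exists u, classic_profile omega a f sigma u).
  assert (Hlow : forall sigma, speed sigma -> c <= sigma).
  { intros sigma [u Hu].
    now apply (wave_speed_lower_bound omega a a_u a_s) with (f := f) (M0 := M0) (u := u). }
  destruct (some_speed omega a a_u a_s) with (f := f) (df := df) (L := L)
    as [sigma0 Hsigma0]; try easy.
  (* The infimum of the speeds is obtained as minus the supremum of their opposites. *)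
  destruct (completeness (fun r => speed (- r))) as [r [Hr1 Hr2]].
  { exists (- c). intros r Hr. specialize (Hlow _ Hr). lra. }
  { exists (- sigma0). now rewrite Ropp_involutive. }
  exists (- r). split; [|split].
  - assert (r <= - c); [|lra]. apply Hr2. intros r' Hr'. specialize (Hlow _ Hr'). lra.
  - intros sigma Hsigma. apply travelling_wave_iff_profile.
    (* Since [sigma] exceeds the infimum, some attained speed lies at or below it; [faster_wave]
       then climbs from there to [sigma]. *)
    assert (Hex : exists sigma1, speed sigma1 /\ sigma1 <= sigma).
    { apply NNPP. intros Hn. assert (r <= - sigma); [|lra].
      apply Hr2. intros r' Hr'. apply Rnot_lt_le. intros Hlt. apply Hn.
      exists (- r'). split; [easy|lra]. }
    destruct Hex as [sigma1 [[u Hu] Hle]].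
    now apply (faster_wave omega a a_u a_s) with (df := df) (L := L) (sigma := sigma1)
      (u := u) (s0 := s0) (m0 := m0) (M0 := M0).
  - intros sigma Hsigma HU. apply travelling_wave_iff_profile in HU.
    assert (- sigma <= r); [|lra]. apply Hr1. now rewrite Ropp_involutive.
Qed.
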